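(* Let $q$ be a power of a prime $p$, $k=\mathbb{F}_q(t)$, and $S=\{D_1,\dots,D_l\}$ a finite set of nonconstant elements of $k$ such that $K=k(\alpha_1,\dots,\alpha_l)$, with $\alpha_i^p-\alpha_i=D_i$, is a geometric extension of $k$ (full constant field $\mathbb{F}_q$). Let $\gamma_S$ be the cardinality of $$\{(a_1,\dots,a_l)\in\mathbb{F}_p^l \mid a_1D_1+\cdots+a_lD_l=F^p-F \text{ for some } F\in k\}.$$ Let $\mathscr{M}$ be the set of monic irreducible $P\in\mathbb{F}_q[t]$ with $\mathrm{ord}_P(D_i)\ge0$ for all $i$ and $\{\frac{D_1}{P}\}=\cdots=\{\frac{D_l}{P}\}=0$. Then the relative density of $\mathscr{M}$ exists and equals $\gamma_S/p^l$.
   Context: For monic irreducible $P$ and $D\in k$ with $\mathrm{ord}_P(D)\ge0$, the Hasse symbol is $\{\frac{D}{P}\}=\mathrm{tr}_{\mathbb{F}_q/\mathbb{F}_p}\mathrm{tr}_{(\mathbb{F}_q[t]/P)/\mathbb{F}_q}(D\bmod P)\in\mathbb{F}_p$. A set $T$ of monic irreducible polynomials has relative density $\varepsilon$ if $\lim_{N\to\infty}\#\{P\in T:\deg P=N\}/\pi(N)=\varepsilon$, where $\pi(N)$ is the number of monic irreducible polynomials of degree $N$. *)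

(* Defs.v *)
From HB Require Import structures.
From mathcomp Require Import all_boot all_order all_algebra all_field.
From mathcomp Require Import all_classical all_reals all_analysis.

Set Implicit Arguments.
Unset Strict Implicit.
Unset Printing Implicit Defensive.

Import Order.TTheory GRing.Theory Num.Theory.
Import numFieldNormedType.Exports.

Local Open Scope ring_scope.

Notation ratfun F := {fraction {poly F}}.

Definition ratconst (F : fieldType) (c : F) : ratfun F := @FracField.tofrac _ c%:P.

Definition nonconstant (F : fieldType) (D : ratfun F) : Prop :=
  forall c : F, D <> ratconst c.

(* Multiplicity of P in f, for f != 0 and P nonconstant: P ^+ e %| f then
   forces e < size f, so the bound on e is harmless. *)
Definition multp (F : fieldType) (P f : {poly F}) : nat :=
  \max_(e < size f | P ^+ e %| f) e.

Definition ord_at (F : fieldType) (P : {poly F}) (D : ratfun F) : \bar int :=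
  if D == 0 then +oo%E
  else ((multp P (repr D).1)%:Z - (multp P (repr D).2)%:Z)%:E.

(* The representative [repr D] need not be in lowest terms, hence the division
   by the gcd. If ord_P(D) >= 0 the reduced denominator is prime to P; otherwise
   the value is junk (division by 0). *)
Definition residue (F : fieldType) (P : {poly F})
    (mi : monic_irreducible_poly P) (D : ratfun F) : {poly %/ P with mi} :=
  let n := (repr D).1 in
  let d := (repr D).2 in
  let g := gcdp n d in
  (in_qpoly P (n %/ g) : {poly %/ P with mi}) / in_qpoly P (d %/ g).

(* Trace of multiplication by a. *)
Definition alg_trace (F : fieldType) (A : falgType F) (a : A) : F :=
  \tr (passmx.mxof (vbasis {:A}) (vbasis {:A}) (amulr a)).

(* [pPrimeCharType hp] is F viewed as an algebra over its prime field 'F_p. *)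
Definition hasse_symbol (p : nat) (F : finFieldType) (hp : p \in [pchar F])
    (P : {poly F}) (mi : monic_irreducible_poly P) (D : ratfun F) : 'F_p :=
  alg_trace (alg_trace (residue mi D) : pPrimeCharType hp).

Definition monic_irreducibles (F : fieldType) : set {poly F} :=
  [set P | irreducible_poly P /\ P \is monic]%classic.

Definition count_degree (F : finFieldType) (T : set {poly F}) (N : nat) : nat :=
  #|[pred P : {poly_(N.+1) F} |
      (size (val P) == N.+1) && `[< T (val P) >]]|.

Definition has_relative_density (R : realType) (F : finFieldType)
    (T : set {poly F}) (eps : R) : Prop :=
  ((fun N => (count_degree T N)%:R / (count_degree (@monic_irreducibles F) N)%:R)
     @ \oo --> eps)%classic.

Definition const_embed (F : fieldType) (K : fieldExtType (ratfun F)) (c : F) : K :=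
  (ratconst c)%:A.

Definition geometric_ext (F : fieldType) (K : fieldExtType (ratfun F)) : Prop :=
  forall x : K, algebraicOver (@const_embed F K) x ->
    exists c : F, x = const_embed K c.

(* [a i : 'F_p] acts on F(t) through its representative in {0, .., p - 1};
   this is the F_p-module structure since F(t) has characteristic p. *)
Definition gamma_card (p : nat) (F : finFieldType) (l : nat)
    (D : 'I_l -> ratfun F) : nat :=
  #|[pred a : {ffun 'I_l -> 'F_p} |
      `[< exists G : ratfun F,
            \sum_(i < l) (a i : nat)%:R * D i = G ^+ p - G >]]|.

Definition hasse_zero_set (p : nat) (F : finFieldType) (hp : p \in [pchar F])
    (l : nat) (D : 'I_l -> ratfun F) : set {poly F} :=
  [set P | exists mi : monic_irreducible_poly P,
     forall i, (0 <= ord_at P (D i))%E /\ hasse_symbol hp mi (D i) = 0]%classic.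

(* Main.v *)
Require Import Defs.
From HB Require Import structures.
From mathcomp Require Import all_boot all_order all_algebra all_field.
From mathcomp Require Import all_classical all_reals all_analysis.
From mathcomp Require Import zify ring.

Set Implicit Arguments.
Unset Strict Implicit.
Unset Printing Implicit Defensive.

Import Order.TTheory GRing.Theory Num.Theory.
Import numFieldNormedType.Exports.

Local Open Scope ring_scope.

(** Let K be an algebraic closure of F_q.  A prime P of degree N corresponds to
its N roots x in F_(q^N), and its Hasse symbol at D is the absolute trace of
D(x); so, up to the O(q^(N/2)) elements of smaller degree, one has to count the
x in F_(q^N) with Tr(D_i(x)) = 0 for all i.  Counting, for a in F_p^l, the x with
Tr(f_a(x)) = 0, where f_a = a_1 D_1 + ... + a_l D_l, and summing over a gives this
number.  If f_a = G^p - G, every regular x occurs.  Otherwise f_a is not of the form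
G^p - G + c either, because the extension is geometric, and modulo elements
G^p - G it has a pole of order prime to p.  The Stepanov-Bombieri method applied
to y^p - y = f_a - c then gives at most q^N/p + O(q^(N/2)) points x with
Tr(f_a(x)) = t, for each t in F_p; as these p numbers add up to q^N + O(1), each of
them is q^N/p + O(q^(N/2)). *)

(** * The Stepanov-Bombieri method *)

Section WeightedDegree.
Variables (K : fieldType) (p D : nat).
Implicit Types s : {poly {poly K}}.

(* The inner variable z has weight p and the outer variable Y has weight D: these are
   their pole orders on the curve Y^p = A(z) Y + B(z) when deg B = D. *)
Definition weight_le s (w : nat) : Prop :=
  forall k i, s`_k`_i != 0 -> (p * i + D * k <= w)%N.

Lemma weight_le_trans s w w' : weight_le s w -> (w <= w')%N -> weight_le s w'.
Proof. by move=> hs ww' k i /hs /leq_trans; apply. Qed.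

Lemma weight_leD s s' w : weight_le s w -> weight_le s' w -> weight_le (s + s') w.
Proof.
move=> hs hs' k i; rewrite !coefD; case: (eqVneq s`_k`_i 0) => [->|/hs //].
by rewrite add0r => /hs'.
Qed.

Lemma weight_leN s w : weight_le s w -> weight_le (- s) w.
Proof. by move=> hs k i; rewrite !coefN oppr_eq0 => /hs. Qed.

Lemma weight_le_sum (I : Type) (r : seq I) (P : pred I) (E : I -> {poly {poly K}}) w :
  (forall i, P i -> weight_le (E i) w) -> weight_le (\sum_(i <- r | P i) E i) w.
Proof.
move=> hE; apply: (big_ind (weight_le^~ w)) => //; last by move=> x y; apply: weight_leD.
by move=> k i; rewrite !coef0 eqxx.
Qed.

Lemma weight_leM s s' w w' : weight_le s w -> weight_le s' w' -> weight_le (s * s') (w + w').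
Proof.
move=> hs hs' k i; apply: contraNT; rewrite -ltnNge => hlt.
rewrite coefM coef_sum big1 // => a _; rewrite coefM big1 // => b _.
case: (eqVneq s`_a`_b 0) => [->|/hs h1]; first by rewrite mul0r.
case: (eqVneq s'`_(k - a)`_(i - b) 0) => [->|/hs' h2]; first by rewrite mulr0.
have := ltn_ord a; have := ltn_ord b; rewrite !ltnS => hb ha.
move: hlt h1 h2; rewrite -{1}(subnKC hb) -{1}(subnKC ha) !mulnDr; lia.
Qed.

Lemma weight_le_exp s w n : weight_le s w -> weight_le (s ^+ n) (n * w).
Proof.
move=> hs; elim: n => [|n IH]; last by rewrite exprS mulSn; apply: weight_leM.
move=> k i; rewrite expr0 coef1; case: k => [|k]; last by rewrite coef0 eqxx.
by rewrite coef1; case: i => [|i]; rewrite ?eqxx ?muln0.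
Qed.

Lemma weight_leC (c : {poly K}) : weight_le c%:P (p * (size c).-1).
Proof.
move=> k i; rewrite coefC; case: k => [|k] /=; last by rewrite coef0 eqxx.
move=> hi; rewrite muln0 addn0 leq_mul2l; apply/orP; right.
have : (i < size c)%N by rewrite ltnNge; apply: contra hi => /leq_sizeP ->.
by case: (size c).
Qed.

Lemma weight_leX : weight_le 'X D.
Proof.
move=> k i; rewrite coefX; case: k => [|[|k]] /=; rewrite ?coef0 ?eqxx //.
by rewrite coef1; case: i => [|i]; rewrite ?eqxx // muln0 muln1.
Qed.

Variables (beta : K).

(* z = tau^p, Y = beta tau^D turns weights into degrees; as p does not divide D, this
   is injective on polynomials of degree < p in Y. *)
Definition theta s : {poly K} :=
  (map_poly (comp_poly 'X^p) s).[beta *: 'X^D].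

Lemma thetaD s s' : theta (s + s') = theta s + theta s'.
Proof. by rewrite /theta rmorphD hornerD. Qed.

Lemma thetaN s : theta (- s) = - theta s.
Proof. by rewrite /theta rmorphN hornerN. Qed.

Lemma thetaM s s' : theta (s * s') = theta s * theta s'.
Proof. by rewrite /theta rmorphM hornerM. Qed.

Lemma thetaC (c : {poly K}) : theta c%:P = c \Po 'X^p.
Proof. by rewrite /theta map_polyC hornerC. Qed.

Lemma theta_exp s n : theta (s ^+ n) = theta s ^+ n.
Proof. by rewrite /theta rmorphXn horner_exp. Qed.

Lemma thetaX : theta 'X = beta *: 'X^D.
Proof. by rewrite /theta map_polyX hornerX. Qed.

Lemma theta_sum (I : Type) (r : seq I) (P : pred I) (E : I -> {poly {poly K}}) :
  theta (\sum_(i <- r | P i) E i) = \sum_(i <- r | P i) theta (E i).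
Proof. by rewrite /theta rmorph_sum horner_sum. Qed.

Lemma thetaE s : theta s =
  \sum_(k < size s) (s`_k \Po 'X^p) * (beta ^+ k *: 'X^(D * k)).
Proof.
rewrite -{1}[s]coefK poly_def theta_sum; apply: eq_bigr => k _.
by rewrite -mul_polyC thetaM thetaC theta_exp thetaX exprZn -exprM.
Qed.

Lemma coef_theta s n : (0 < p)%N -> (theta s)`_n =
  \sum_(k < size s | (D * k <= n)%N && (p %| n - D * k)%N)
     beta ^+ k * s`_k`_((n - D * k) %/ p).
Proof.
move=> p0; rewrite thetaE coef_sum [RHS]big_mkcond; apply: eq_bigr => k _.
rewrite -scalerAr coefZ coefMXn ltnNge; case: leqP => //= _; last by rewrite mulr0.
by rewrite coef_comp_poly_Xn //; case: ifP => //; rewrite mulr0.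
Qed.

Lemma size_theta s w : (0 < p)%N -> weight_le s w -> (size (theta s) <= w.+1)%N.
Proof.
move=> p0 hs; apply/leq_sizeP => n hn; rewrite coef_theta // big1 // => k.
case/andP=> hk /divnK hd; apply/eqP; rewrite mulf_eq0; apply/orP; right.
by apply: contraLR hn => /hs; rewrite mulnC hd subnK // -leqNgt.
Qed.

Lemma weight_inj i j i' j' : prime p -> ~~ (p %| D)%N -> (j < p)%N -> (j' < p)%N ->
  (p * i + D * j = p * i' + D * j')%N -> (i = i') /\ (j = j').
Proof.
move=> pp pD hj hj' e; have p0 := prime_gt0 pp.
suff ej : j = j'.
  by move: e; rewrite ej => /addIn /eqP; rewrite eqn_pmul2l // => /eqP.
have cp : coprime p D by rewrite prime_coprime.
wlog le_jj : i i' j j' hj hj' e / (j <= j')%N.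
  move=> H; case: (leqP j j') => [/H|/ltnW hh]; first by apply; eauto.
  by symmetry; apply: (H i' i j' j).
have : (p %| D * (j' - j))%N.
  have -> : (D * (j' - j) = p * i - p * i')%N by rewrite mulnBr; lia.
  by rewrite -mulnBr dvdn_mulr.
rewrite Gauss_dvdr // => /dvdn_leq; lia.
Qed.

Lemma theta_inj s : prime p -> ~~ (p %| D)%N -> beta != 0 ->
  (size s <= p)%N -> theta s = 0 -> s = 0.
Proof.
move=> pp pD b0 hs th; have p0 := prime_gt0 pp.
apply/polyP => j; apply/polyP => i; rewrite !coef0.
case: (ltnP j (size s)) => [hj|hj]; last by rewrite [s`_j]nth_default ?coef0.
have := congr1 (fun q : {poly K} => q`_(p * i + D * j)) th.
rewrite /= coef_theta // ?coef0 (bigD1 (Ordinal hj)) /=; last first.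
  by rewrite leq_addl addnK dvdn_mulr.
rewrite addnK mulKn // big1 ?addr0 => [/eqP|k].
  by rewrite mulf_eq0 expf_eq0 (negPf b0) andbF => /eqP.
case/andP=> /andP[h1 /divnK h2] nk; case/eqP: nk; apply: val_inj => /=.
have [|||_ //] := @weight_inj ((p * i + D * j - D * k) %/ p) k i j pp pD.
- exact: leq_trans (ltn_ord k) hs.
- exact: leq_trans hs.
- by rewrite mulnC h2 subnK.
Qed.

End WeightedDegree.

Arguments weight_leC {K} p D c.
Arguments weight_leX {K} p D.

Section Reduction.
Import Pdiv.CommonRing Pdiv.RingMonic.
Variables (K : fieldType) (p D : nat) (beta : K) (A B : {poly K}).
Hypotheses (pp : prime p) (sB : size B = D.+1) (lB : lead_coef B = beta ^+ p).
Hypothesis sA : (p * (size A).-1 + D < p * D)%N.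
Implicit Types s : {poly {poly K}}.

Definition curve_eq : {poly {poly K}} := 'X^p - (A *: 'X + B%:P).

Let size_tail : (size (A *: 'X + B%:P)%R <= p)%N.
Proof.
apply: leq_trans (size_polyD _ _) _; rewrite geq_max; apply/andP; split.
  apply: leq_trans (size_scale_leq _ _) _.
  by rewrite size_polyX prime_gt1.
by apply: leq_trans (size_polyC_leq1 _) (prime_gt0 pp).
Qed.

Lemma size_curve_eq : size curve_eq = p.+1.
Proof. by rewrite size_polyDl ?size_polyXn // size_polyN ltnS. Qed.

Lemma monic_curve_eq : curve_eq \is monic.
Proof.
rewrite monicE /curve_eq lead_coefDl ?lead_coefXn //.
by rewrite size_polyXn size_polyN ltnS.
Qed.

Lemma weight_le_curve_eq : weight_le p D curve_eq (p * D).
Proof.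
apply: weight_leD; first by apply: weight_le_exp; apply: weight_leX.
apply: weight_leN; apply: weight_leD; last first.
  by apply: weight_le_trans (weight_leC p D _) _; rewrite sB.
rewrite -mul_polyC; apply: weight_le_trans (weight_leM (weight_leC p D _) (weight_leX p D)) _.
exact: ltnW.
Qed.

Lemma size_theta_curve_eq : (size (theta p D beta curve_eq) <= p * D)%N.
Proof.
have p0 := prime_gt0 pp.
have h : (size (theta p D beta curve_eq) <= (p * D).+1)%N.
  by apply: size_theta p0 weight_le_curve_eq.
apply/leq_sizeP => n; rewrite leq_eqVlt => /predU1P[<-|hn]; last first.
  by move/leq_sizeP: h; apply.
rewrite /curve_eq thetaD thetaN thetaD -mul_polyC thetaM !thetaC thetaX.
rewrite theta_exp thetaX exprZn -exprM !(coefD, coefN, coefZ, coefXn).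
rewrite [(D * p)%N]mulnC eqxx mulr1 -scalerAr coefZ coefMXn.
rewrite !coef_comp_poly_Xn // dvdn_mulr // mulKn //.
have -> : B`_D = beta ^+ p by rewrite -lB lead_coefE sB.
have D0 : (0 < D)%N by case: (D) sA; rewrite ?muln0.
have hlt : (D <= p * D)%N by apply: leq_pmull.
rewrite ltnNge hlt /=; case: ifP => [/divnK e|]; last by rewrite mulr0 add0r subrr.
rewrite nth_default ?mulr0 ?add0r ?subrr //.
rewrite leqNgt -ltnS; apply/negP => hk.
have : (p * ((p * D - D) %/ p) <= p * (size A).-1)%N.
  by rewrite leq_mul2l; apply/orP; right; case: (size A) hk.
by rewrite mulnC e; lia.
Qed.

(* With beta^p = lead_coef B the leading terms of theta (Y^p - A Y - B) cancel, so that
   reduction modulo the curve keeps the coefficient of highest weight. *)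
Lemma weight_le_rmod s w : weight_le p D s w ->
  weight_le p D (rmodp s curve_eq) w /\
  (theta p D beta (rmodp s curve_eq))`_w = (theta p D beta s)`_w.
Proof.
move: {2}(size s) (leqnn (size s)) => n.
elim: n s => [|n IH] s hs ws.
  move: hs; rewrite leqn0 size_poly_eq0 => /eqP s0.
  by move: ws; rewrite s0 rmod0p.
case: (leqP (size s) p) => [hp|hp].
  by rewrite rmodp_small ?size_curve_eq.
set c := lead_coef s; pose k := ((size s).-1 - p)%N.
have ek : (size s).-1 = (k + p)%N by rewrite subnK //; case: (size s) hp.
pose q := c *: 'X^k : {poly {poly K}}.
pose s' := s - q * curve_eq.
have s0 : c != 0 by rewrite lead_coef_eq0 -size_poly_gt0; apply: leq_trans hp.
have wq : exists2 w', weight_le p D q w' & (w' + p * D = w)%N.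
  have hc : (p * (size c).-1 + D * (k + p) <= w)%N.
    apply: ws; rewrite -ek -[s`_ _]/(lead_coef s) -/c.
    by rewrite -[c`_ _]/(lead_coef c) lead_coef_eq0.
  exists (w - p * D)%N; last by rewrite subnK //; nia.
  rewrite /q -mul_polyC.
  apply: weight_le_trans (weight_leM (weight_leC p D _) (weight_le_exp (n := k) (weight_leX p D))) _.
  nia.
have [w' wq' ew] := wq.
have ws' : weight_le p D s' w.
  apply: weight_leD => //; apply: weight_leN; rewrite -ew.
  exact: weight_leM wq' weight_le_curve_eq.
have hs' : (size s' <= n)%N.
  have sq : size (q * curve_eq) = size s.
    rewrite size_Mmonic ?monic_curve_eq //; last first.
      by rewrite /q -mul_polyC mulf_eq0 polyC_eq0 negb_or s0 -size_poly_eq0 size_polyXn.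
    rewrite size_curve_eq /q size_scale // size_polyXn addSn /= addnS -ek.
    by case: (size s) hp.
  have : (size s' < size s)%N.
    rewrite -[X in (_ < X)%N]prednK; last by apply: leq_trans hp.
    rewrite ltnS; apply/leq_sizeP => j; rewrite leq_eqVlt => /predU1P[<-|hj].
      rewrite coefB -[s`_ _]/(lead_coef s) -sq -[(q * _)`_ _]/(lead_coef _).
      by rewrite lead_coef_Mmonic ?monic_curve_eq // /q lead_coefZ lead_coefXn mulr1 subrr.
    have hj' : (size s <= j)%N by case: (size s) hj.
    by rewrite coefB !nth_default ?subrr // sq.
  by move=> h; rewrite -ltnS; apply: leq_trans h hs.
have er : rmodp s curve_eq = rmodp s' curve_eq.
  by rewrite /s' rmodpB ?monic_curve_eq // rmodp_mull ?monic_curve_eq // subr0.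
rewrite er; have [h1 h2] := IH _ hs' ws'; split=> //.
rewrite h2 /s' thetaD thetaN thetaM coefB [X in _ - X]nth_default ?subr0 //.
apply: leq_trans (size_polyMleq _ _) _.
rewrite -ew -subn1 leq_subLR addnA add1n; apply: leq_add.
  exact: size_theta (prime_gt0 pp) wq'.
exact: size_theta_curve_eq.
Qed.

End Reduction.

Lemma closed_pow_root (K : closedFieldType) (n : nat) (c : K) :
  (0 < n)%N -> exists b : K, b ^+ n = c.
Proof.
move=> n0; have /closed_rootP[x] : size ('X^n - c%:P) != 1%N.
  by rewrite size_XnsubC //; case: n n0.
by rewrite /root !hornerE subr_eq0 => /eqP; exists x.
Qed.

Lemma pchar_exprD (K : fieldType) p n (x y : K) :
  p \in [pchar K] -> (x + y) ^+ (p ^ n) = x ^+ (p ^ n) + y ^+ (p ^ n).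
Proof.
move=> hp; apply: exprDn_pchar; rewrite pnatX; apply/orP; left.
by rewrite pnatE // (pcharf_prime hp).
Qed.

Lemma pchar_expr_sum (K : fieldType) p n (I : Type) (r : seq I) (E : I -> K) :
  p \in [pchar K] ->
  (\sum_(i <- r) E i) ^+ (p ^ n) = \sum_(i <- r) E i ^+ (p ^ n).
Proof.
move=> hp; elim: r => [|i r IH]; last by rewrite !big_cons pchar_exprD // IH.
by rewrite !big_nil expr0n expn_eq0 -leqn0 leqNgt prime_gt0 ?(pcharf_prime hp).
Qed.

Section Stepanov.
Import Pdiv.CommonRing Pdiv.RingMonic.
Variables (K : closedFieldType) (p D M : nat) (A B v : {poly K}).
Variables (mu nu I0 A0 : nat).
Hypotheses (hp : p \in [pchar K]) (sB : size B = D.+1) (pD : ~~ (p %| D)%N).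
Hypothesis sA : (p * (size A).-1 + D < p * D)%N.
Hypothesis sv : (size v <= 2)%N.
Hypothesis hI : (p * I0 + D * p <= p ^ nu)%N.
Hypothesis hcount :
  ((p ^ mu * (p * I0 + D * p) + p * (A0 + M * p) + D * p).+1 < I0 * p * (A0 * p))%N.

Let pp : prime p := pcharf_prime hp.
Let p0 : (0 < p)%N := prime_gt0 pp.
Let Phi := curve_eq p A B.
Let idx := ('I_I0 * 'I_p * ('I_A0 * 'I_p))%type.
Let T := (A0 + M * p)%N.
Let T' := (p ^ mu * (p * I0 + D * p) + p * T + D * p)%N.

(* The auxiliary polynomial is w = sum_x c_x aux_monom x.  At the points counted,
   v^T w^(p^mu) = sum_x c_x^(p^mu) test x, by the Frobenius relations between v, z
   and Y; the c_x are chosen so that the right-hand side vanishes on the curve. *)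
Let test (x : idx) : {poly {poly K}} :=
  ('X^(x.1.1 * p ^ mu + x.2.1) * v ^+ (T - (x.2.1 + M * x.2.2)))%:P
  * 'X^(p ^ mu * x.1.2 + x.2.2).

Let wt (x : idx) : nat :=
  (p * (x.1.1 + x.2.1 * p ^ nu) + D * (x.1.2 + x.2.2 * p ^ nu))%N.

Let aux_monom (x : idx) : {poly {poly K}} :=
  ('X^(x.1.1 + x.2.1 * p ^ nu))%:P * 'X^(x.1.2 + x.2.2 * p ^ nu).

Let size_exp_lin n : ((size (v ^+ n)%R).-1 <= n)%N.
Proof.
have := size_poly_exp_leq v n; have : ((size v).-1 * n <= n)%N.
  by rewrite -[X in (_ <= X)%N]mul1n leq_mul2r; case: (size v) sv => [|[|[]]] // *; rewrite orbT.
by move=> h1 h2; case: (size _) h2 => //= k; rewrite ltnS => /leq_trans; apply.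
Qed.

Let in_T (x : idx) : (x.2.1 + M * x.2.2 <= T)%N.
Proof.
apply: leq_add; first exact: ltnW.
by rewrite leq_mul2l ltnW ?orbT.
Qed.

Let weight_le_test x : weight_le p D (test x) T'.
Proof.
apply: weight_le_trans (weight_leM (weight_leC p D _) (weight_le_exp (n := _) (weight_leX p D))) _.
set P1 := 'X^_; set n := (T - _)%N.
have hs : ((size (P1 * v ^+ n)%R).-1 <= (x.1.1 * p ^ mu + x.2.1) + n)%N.
  apply: (@leq_trans (size P1 + size (v ^+ n)%R).-2).
    by have := size_polyMleq P1 (v ^+ n); move: (size (P1 * _)) => [|k] //=; lia.
  rewrite size_polyXn; have := size_exp_lin n; set a := size _; set b := (_ + _)%N; lia.
apply: (@leq_trans (p * (x.1.1 * p ^ mu + T) + (p ^ mu * x.1.2 + x.2.2) * D)%N).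
  rewrite leq_add2r leq_mul2l; apply/orP; right; apply: leq_trans hs _.
  rewrite -addnA leq_add2l /n; move: (in_T x); move: (M * _)%N T; lia.
rewrite /T'; have := ltn_ord x.1.1; have := ltn_ord x.1.2; have := ltn_ord x.2.2.
move: (val x.1.1) (val x.1.2) (val x.2.2) => i j b hb hj hi.
have h1 : (p ^ mu * (p * i + D * j) <= p ^ mu * (p * I0 + D * p))%N.
  by rewrite leq_mul2l leq_add ?orbT // leq_mul2l ltnW ?orbT.
have h2 : (D * b <= D * p)%N by rewrite leq_mul2l ltnW ?orbT.
move: h1 h2; rewrite !mulnDr !mulnDl ![(p ^ mu * _)%N]mulnC ![(_ * D)%N]mulnC.
rewrite !mulnA; lia.
Qed.

Let beta_neq0 beta : beta ^+ p = lead_coef B -> beta != 0.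
Proof.
move=> hb; have : lead_coef B != 0 by rewrite lead_coef_eq0 -size_poly_eq0 sB.
by rewrite -hb expf_eq0 p0.
Qed.

Let aux_kernel beta : beta ^+ p = lead_coef B -> exists e : idx -> K,
  (exists x, e x != 0) /\
  rmodp (\sum_x (e x)%:P *: test x) Phi = 0.
Proof.
move=> hb; have lB := esym hb.
pose phi x := theta p D beta (rmodp (test x) Phi).
have sphi x : (size (phi x) <= T'.+1)%N.
  apply: size_theta => //.
  by have [] := weight_le_rmod pp sB lB sA (@weight_le_test x).
pose Mx := \matrix_(k < #|{: idx}|) (poly_rV (phi (enum_val k)) : 'rV[K]_T'.+1).
have : kermx Mx != 0.
  rewrite -mxrank_eq0 mxrank_ker subn_eq0 -ltnNge.
  apply: leq_ltn_trans (rank_leq_col _) _.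
  by rewrite !card_prod !card_ord.
case/rowV0Pn => u /sub_kermxP hu u0; exists (fun x => u 0 (enum_rank x)); split.
  case/matrix0Pn: u0 => i [j uj]; exists (enum_val j).
  by rewrite enum_valK -(ord1 i).
have b0 := beta_neq0 hb.
apply: (theta_inj pp pD b0).
  by rewrite -ltnS -(size_curve_eq A B pp) ltn_rmodp monic_neq0 ?monic_curve_eq.
rewrite rmodp_sum ?monic_curve_eq // theta_sum.
apply/polyP => n; rewrite coef0 coef_sum.
have -> : \sum_x (theta p D beta (rmodp ((u 0 (enum_rank x))%:P *: test x) Phi))`_n =
  \sum_x u 0 (enum_rank x) * (phi x)`_n.
  apply: eq_bigr => x _; rewrite rmodpZ ?monic_curve_eq // -mul_polyC.
  by rewrite thetaM thetaC comp_polyC coefCM.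
case: (ltnP n T'.+1) => hn; last first.
  rewrite big1 // => x _; rewrite nth_default ?mulr0 //.
  exact: leq_trans (sphi x) hn.
have := congr1 (fun w : 'rV_T'.+1 => w 0 (Ordinal hn)) hu.
rewrite !mxE (reindex enum_rank) /=; last first.
  by exists enum_val => x _; rewrite ?enum_valK ?enum_rankK.
by move=> h; rewrite -[RHS]h; apply: eq_bigr => x _; rewrite !mxE enum_rankK.
Qed.

Let wt_inj : injective wt.
Proof.
case=> [[i j] [a b]] [[i' j'] [a' b']]; rewrite /wt /=.
have small (k : 'I_I0) (m : 'I_p) : (p * k + D * m < p ^ nu)%N.
  apply: leq_trans hI; rewrite -addnS leq_add ?leq_mul2l ?(ltnW (ltn_ord k)) ?orbT //.
  have [D0|D0] := posnP D; last by rewrite ltn_mul2l D0 ltn_ord.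
  by move: pD; rewrite D0 dvdn0.
have split_wt (k m x y : nat) : (p * (k + x * p ^ nu) + D * (m + y * p ^ nu) =
   (p * x + D * y) * p ^ nu + (p * k + D * m))%N by rewrite !mulnDr !mulnDl !mulnA; lia.
rewrite !split_wt => e.
have pn0 : (0 < p ^ nu)%N by rewrite expn_gt0 p0.
have e1 : (p * a + D * b = p * a' + D * b')%N.
  by have := congr1 (fun t => t %/ p ^ nu)%N e; rewrite /= !divnMDl // !divn_small ?addn0.
have e2 : (p * i + D * j = p * i' + D * j')%N.
  by move: e; rewrite e1 => /addnI.
have [||/val_inj-> /val_inj->] := weight_inj pp pD _ _ e1; rewrite ?ltn_ord //.
by have [||/val_inj-> /val_inj->] := weight_inj pp pD _ _ e2; rewrite ?ltn_ord.
Qed.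

Let weight_le_aux x : weight_le p D (aux_monom x) (wt x).
Proof.
apply: weight_le_trans (weight_leM (weight_leC p D _) (weight_le_exp (n := _) (weight_leX p D))) _.
by rewrite size_polyXn /= /wt [(_ * D)%N]mulnC.
Qed.

Lemma stepanov (Z : seq K) : uniq Z ->
  (forall z, z \in Z -> v.[z] != 0 /\ v.[z] * z ^+ (p ^ (mu + nu)) = z /\
    exists Ys : seq K, uniq Ys /\ size Ys = p /\
     forall Y, Y \in Ys -> Y ^+ p = A.[z] * Y + B.[z] /\
       v.[z] ^+ M * Y ^+ (p ^ (mu + nu)) = Y) ->
  (p * size Z <= p * I0 + D * p + p ^ nu * (p * A0 + D * p))%N.
Proof.
move=> uZ hZ.
have [beta hb] := closed_pow_root (lead_coef B) p0.
have [e [[x0 ex0] he]] := aux_kernel hb.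
have /fin_all_exists[c hc] : forall x : idx, exists cx, cx ^+ (p ^ mu) = e x.
  by move=> x; apply: closed_pow_root; rewrite expn_gt0 p0.
have cx0 : c x0 != 0.
  by apply: contraNneq ex0; rewrite -hc => ->; rewrite expr0n expn_eq0 (gtn_eqF p0).
pose w := \sum_x (c x)%:P%:P * aux_monom x.
pose r := rmodp w Phi.
have [x1 cx1 max1] := @arg_maxnP _ x0 (fun x => c x != 0) wt cx0.
have ww : weight_le p D w (wt x1).
  apply: weight_le_sum => x _; have [c0|c0] := eqVneq (c x) 0.
    by move=> k i; rewrite c0 !polyC0 mul0r !coef0 eqxx.
  apply: weight_le_trans (weight_leM (weight_leC p D _) (@weight_le_aux x)) _.
  by rewrite size_polyC c0 muln0 add0n; apply: max1.
have [wr tr] := weight_le_rmod pp sB (esym hb) sA ww.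
have b0 := beta_neq0 hb.
have r0 : r != 0.
  apply: contraTneq cx1 => r0; rewrite negbK.
  move: tr; rewrite -/Phi -/r r0 /theta rmorph0 horner0 coef0 -/(theta p D beta w).
  rewrite theta_sum coef_sum (bigD1 x1) //= big1 => [|x nx].
    rewrite addr0 thetaM thetaC comp_polyC coefCM thetaM thetaC theta_exp thetaX.
    rewrite comp_Xn_poly exprZn -!exprM -scalerAr -exprD coefZ coefXn.
    rewrite -/(wt x1) eqxx mulr1 => /esym/eqP.
    by rewrite mulf_eq0 expf_eq0 (negPf b0) andbF orbF.
  rewrite thetaM thetaC comp_polyC coefCM thetaM thetaC theta_exp thetaX.
  rewrite comp_Xn_poly exprZn -!exprM -scalerAr -exprD coefZ coefXn -/(wt x).
  by rewrite (inj_eq wt_inj) eq_sym (negPf nx) !mulr0.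
have monPhi : Phi \is monic by apply: monic_curve_eq.
have evPhi z Y q : Y ^+ p = A.[z] * Y + B.[z] ->
    (rmodp q Phi).[Y%:P].[z] = q.[Y%:P].[z].
  move=> hY; rewrite [in RHS](rdivp_eq monPhi q) hornerD hornerM hornerD hornerM.
  suff -> : Phi.[Y%:P].[z] = 0 by rewrite mulr0 add0r.
  by rewrite /Phi /curve_eq !(hornerE, horner_exp) /= hY subrr.
have wz z Y : z \in Z -> Y ^+ p = A.[z] * Y + B.[z] ->
    v.[z] ^+ M * Y ^+ (p ^ (mu + nu)) = Y -> r.[Y%:P].[z] = 0.
  move=> /hZ[vz [ez _]] hY eY; rewrite evPhi //.
  suff : w.[Y%:P].[z] ^+ (p ^ mu) = 0 by move/eqP; rewrite expf_eq0 => /andP[_ /eqP].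
  have /eqP := evPhi z Y (\sum_x (e x)%:P *: test x) hY.
  rewrite he !horner0 eq_sym.
  suff -> : (\sum_x (e x)%:P *: test x).[Y%:P].[z] = v.[z] ^+ T * w.[Y%:P].[z] ^+ (p ^ mu).
    by rewrite mulf_eq0 expf_eq0 (negPf vz) andbF => /eqP.
  rewrite /w !horner_sum pchar_expr_sum // mulr_sumr; apply: eq_bigr => x _.
  rewrite /test /aux_monom !(hornerE, horner_exp) /= !exprMn hc.
  rewrite -{2}(subnK (in_T x)); move: (T - _)%N => n.
  move: (x.1.1 : nat) (x.1.2 : nat) (x.2.1 : nat) (x.2.2 : nat) => i j a b.
  have -> : z ^+ (i * p ^ mu + a) = z ^+ (i * p ^ mu) * (v.[z] ^+ a * z ^+ (p ^ (mu + nu) * a)).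
    by rewrite exprD; congr (_ * _); rewrite [z ^+ (_ * a)]exprM -exprMn ez.
  have -> : Y ^+ (p ^ mu * j + b) =
      Y ^+ (p ^ mu * j) * (v.[z] ^+ (M * b) * Y ^+ (p ^ (mu + nu) * b)).
    by rewrite exprD; congr (_ * _); rewrite [Y ^+ (_ * b)]exprM exprM -exprMn eY.
  rewrite -!exprM !mulnDl -!mulnA -!expnD [(nu + mu)%N]addnC !exprD.
  rewrite [(j * _)%N]mulnC [(b * _)%N]mulnC [(a * _)%N]mulnC.
  by ring.
have size_r : (size r <= p)%N.
  by rewrite -ltnS -(size_curve_eq A B pp) ltn_rmodp monic_neq0.
have coef_z j z : z \in Z -> (r`_j).[z] = 0.
  move=> zZ; have [_ [_ [Ys [uY [sY hY]]]]] := hZ z zZ.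
  pose rz := map_poly (horner_eval z) r.
  suff : rz = 0 by move/(congr1 (fun q : {poly K} => q`_j)); rewrite coef_map coef0.
  apply: (roots_geq_poly_eq0 (rs := Ys)) => //; last first.
    by rewrite sY (leq_trans (size_poly _ _)).
  apply/allP => Y YY; have [h1 h2] := hY Y YY; rewrite /root.
  rewrite -(wz z Y zZ h1 h2) /rz -[Y in _.[Y]](hornerC Y z).
  by rewrite -/(horner_eval z Y%:P) horner_map.
pose k := (size r).-1.
have k0 : r`_k != 0 by rewrite -[r`_k]/(lead_coef r) lead_coef_eq0.
have szZ : (size Z < size (r`_k)%R)%N.
  apply: max_poly_roots => //; apply/allP => z zZ.
  by rewrite /root coef_z.
have := wr k (size (r`_k)%R).-1; rewrite -[_`_(_.-1)]/(lead_coef _) lead_coef_eq0 => /(_ k0) h.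
apply: leq_trans (_ : wt x1 <= _)%N.
  apply: leq_trans h; apply: leq_trans (leq_addr _ _).
  by rewrite leq_mul2l; apply/orP; right; move: szZ; case: (size (r`_k)%R).
rewrite /wt; have := ltn_ord x1.1.1; have := ltn_ord x1.1.2.
have := ltn_ord x1.2.1; have := ltn_ord x1.2.2.
move: (x1.1.1 : nat) (x1.1.2 : nat) (x1.2.1 : nat) (x1.2.2 : nat) => i j a b.
move=> hb' ha hj hi; rewrite !mulnDr !mulnA.
have h1 : (p * i <= p * I0)%N by rewrite leq_mul2l ltnW ?orbT.
have h2 : (D * j <= D * p)%N by rewrite leq_mul2l ltnW ?orbT.
have h3 : (p * a * p ^ nu <= p ^ nu * p * A0)%N.
  by rewrite mulnC -mulnA !leq_mul2l (ltnW ha) !orbT.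
have h4 : (D * b * p ^ nu <= p ^ nu * D * p)%N.
  by rewrite mulnC -mulnA !leq_mul2l (ltnW hb') !orbT.
by lia.
Qed.
End Stepanov.

Lemma leq_unknowns (p D M X y I A : nat) : (1 < p)%N ->
 let k := D.+1 in let c := (D * p * p * k + p * k + p * p * M + D * p + p * D + 1)%N in
 (c < y <= X)%N -> (p * I + D * p = X)%N -> (p * A = y + p * k)%N ->
 ((y * X + p * (A + M * p) + D * p).+1 < I * p * (A * p))%N.
Proof.
move=> p1 k c /andP[hc hy] eI eA.
have -> : (I * p * (A * p) = (p * I) * (p * A))%N by lia.
have -> : (p * (A + M * p) = p * A + p * p * M)%N by lia.
rewrite eA.
have h1 : ((p * I) * (y + p * k) + D * p * (y + p * k) = X * (y + p * k))%N by rewrite -mulnDl eI.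
have h2 : (X * (y + p * k) = y * X + p * D * X + p * X)%N by rewrite /k; lia.
have h3 : (D * p * (y + p * k) <= D * p * X + D * p * p * k)%N.
  by rewrite mulnDr !mulnA leq_add2r leq_mul2l hy orbT.
have h4 : (2 * X <= p * X)%N by rewrite leq_mul2r p1 orbT.
rewrite /c in hc.
set u := (p * I * (y + p * k))%N in h1 *.
set w := (D * p * (y + p * k))%N in h1 h3.
set t := (D * p * p * k)%N in hc h3.
move: h1 h2 h3 h4; rewrite ![(p * D)%N]mulnC in hc *.
set a := (D * p * X)%N; set b := (p * X)%N; set d := (p * k)%N in hc *; set s := (y * X)%N.
set f := (X * _)%N. set m := (p * p * M)%N in hc *. set n := (D * p)%N in hc *.
clearbody u w t a b d s f m n; clear -hc hy; lia.
Qed.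

Lemma stepanov_asymp (K : closedFieldType) (p D M : nat) :
  p \in [pchar K] -> ~~ (p %| D)%N -> exists C N0 : nat,
  forall (A B v : {poly K}) (mu nu : nat) (Z : seq K),
  size B = D.+1 -> (p * (size A).-1 + D < p * D)%N -> (size v <= 2)%N ->
  (N0 <= mu <= nu)%N -> uniq Z ->
  (forall z, z \in Z -> v.[z] != 0 /\ v.[z] * z ^+ (p ^ (mu + nu)) = z /\
    exists Ys : seq K, uniq Ys /\ size Ys = p /\
     forall Y, Y \in Ys -> Y ^+ p = A.[z] * Y + B.[z] /\
       v.[z] ^+ M * Y ^+ (p ^ (mu + nu)) = Y) ->
  (p * size Z <= p ^ (mu + nu) + C * p ^ nu)%N.
Proof.
move=> hp pD; have pp := pcharf_prime hp.
pose k := D.+1; pose c := (D * p * p * k + p * k + p * p * M + D * p + p * D + 1)%N.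
exists (p * k + D * p + 1)%N, c.+1 => A B v mu nu Z sB sA sv /andP[hmu hnu] uZ hZ.
have big : (c < p ^ mu)%N.
  by apply: leq_trans hmu _; apply: ltnW; apply: ltn_expl; apply: prime_gt1.
have [mu' emu] : exists m, mu = m.+1 by exists mu.-1; case: mu hmu {hnu hZ big}.
have [nu' enu] : exists m, nu = m.+1 by exists nu.-1; case: nu hnu {hZ} => //; lia.
have lemn : (p ^ mu <= p ^ nu)%N by apply: leq_pexp2l; rewrite ?prime_gt0.
have p1 := prime_gt1 pp.
have eI : (p * (p ^ nu' - D) + D * p = p ^ nu)%N.
  rewrite mulnBr -expnS -enu [(D * p)%N]mulnC subnK //.
  by apply: leq_trans lemn; apply: ltnW; apply: leq_trans big; rewrite /c; lia.
have eA : (p * (p ^ mu' + k) = p ^ mu + p * k)%N by rewrite mulnDr -expnS -emu.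
have H : (p * size Z <= p * (p ^ nu' - D) + D * p + p ^ nu * (p * (p ^ mu' + k) + D * p))%N.
  apply: (stepanov (M := M) (mu := mu) hp sB pD sA sv) => //; rewrite ?eI //.
  by apply: leq_unknowns; rewrite ?big.
apply: leq_trans H _; rewrite eI eA expnD.
rewrite -[X in (X + _ <= _)%N]mul1n !mulnDr !mulnDl [(p ^ nu * p ^ mu)%N]mulnC.
rewrite ![(p ^ nu * _)%N]mulnC; lia.
Qed.

Lemma pchar_exprB (K : fieldType) p n (x y : K) :
  p \in [pchar K] -> (x - y) ^+ (p ^ n) = x ^+ (p ^ n) - y ^+ (p ^ n).
Proof.
by move=> hp; apply/(addIr (y ^+ (p ^ n))); rewrite -pchar_exprD // !subrK.
Qed.

Lemma artin_schreier_tele (K : fieldType) p (y : K) m : p \in [pchar K] ->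
  \sum_(i < m) (y ^+ p - y) ^+ (p ^ i) = y ^+ (p ^ m) - y.
Proof.
move=> hp; elim: m => [|m IH]; first by rewrite big_ord0 expn0 expr1 subrr.
by rewrite big_ord_recr /= IH pchar_exprB // -exprM -expnS; ring.
Qed.

Lemma pchar_natr_inj (K : fieldType) p i j : p \in [pchar K] ->
  (i < p)%N -> (j < p)%N -> i%:R = j%:R :> K -> i = j.
Proof.
move=> hp; wlog le_ij : i j / (i <= j)%N.
  by move=> H hi hj e; case: (leqP i j) => [|/ltnW] h; [|symmetry]; apply: H.
move=> hi hj e; have : (j - i)%:R = 0 :> K by rewrite natrB // e subrr.
move/eqP; rewrite -(dvdn_pcharf hp) => /dvdnP[[|k] hk]; first by lia.
by move: hk; rewrite mulSn; lia.
Qed.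

Lemma artin_schreier_roots (K : closedFieldType) p (f : K) : p \in [pchar K] ->
  exists ys : seq K, [/\ uniq ys, size ys = p & forall y, y \in ys -> y ^+ p - y = f].
Proof.
move=> hp; have pp := pcharf_prime hp; have p1 := prime_gt1 pp.
have /closed_rootP[y0] : size ('X^p - 'X - f%:P) != 1%N.
  rewrite -addrA -opprD size_polyDl ?size_polyXn; first by case: p p1 {hp pp}.
  rewrite size_polyN ltnS; apply: leq_trans (size_polyD _ _) _.
  rewrite geq_max size_polyX p1 /=.
  by apply: leq_trans (size_polyC_leq1 _) (ltnW p1).
rewrite /root !(hornerE, hornerXn) subr_eq0 => /eqP hy0.
exists [seq y0 + i%:R | i <- iota 0 p]; split; last 2 first.
- by rewrite size_map size_iota.
- move=> y /mapP[i _ ->]; rewrite -hy0.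
  rewrite -[in X in X - _ = _](expn1 p) pchar_exprD // expn1 -!(pFrobenius_autE hp).
  by rewrite pFrobenius_aut_nat; ring.
rewrite map_inj_in_uniq ?iota_uniq // => i j.
rewrite !mem_iota !add0n /= => hi hj /addrI.
exact: (pchar_natr_inj hp hi hj).
Qed.

(* v accounts for the Frobenius moving the pole rho: for z = 1 / (x - rho), the relation
   x^Q = x becomes v(z) z^Q = z with v = 1 + (rho - rho^Q) z. *)
Lemma artin_schreier_count (K : closedFieldType) p M (g h : {poly K}) :
  p \in [pchar K] -> h != 0 -> (size h < size g)%N -> ~~ (p %| size g - size h)%N ->
  exists C N0 : nat, forall (c : K) (v : {poly K}) (mu nu : nat) (Z : seq K),
  (size v <= 2)%N -> (N0 <= mu <= nu)%N -> uniq Z ->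
  (forall z, z \in Z ->
     [/\ v.[z] != 0, v.[z] * z ^+ (p ^ (mu + nu)) = z, h.[z] != 0,
         v.[z] ^+ M * h.[z] ^+ (p ^ (mu + nu)) = h.[z] &
         \sum_(i < mu + nu) (g.[z] / h.[z] - c) ^+ (p ^ i) = 0]) ->
  (p * size Z <= p ^ (mu + nu) + C * p ^ nu)%N.
Proof.
move=> hp h0 hgh pd; have pp := pcharf_prime hp; have p1 := prime_gt1 pp.
pose D := ((size h).-1 * (p - 1) + (size g).-1)%N.
have sh : (0 < size h)%N by rewrite size_poly_gt0.
have pD : ~~ (p %| D)%N.
  suff -> : D = (p * (size h).-1 + (size g - size h))%N by rewrite dvdn_addr ?dvdn_mulr.
  by rewrite /D mulnBr muln1 mulnC; move: (leq_pmull (size h).-1 (ltnW p1)); lia.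
have [C [N0 H]] := stepanov_asymp M hp pD.
exists C, N0 => c v mu nu Z sv hmu uZ hZ.
have szgc : size (g - c *: h) = size g.
  rewrite size_polyDl // size_polyN; exact: leq_ltn_trans (size_scale_leq _ _) hgh.
have shp : size (h ^+ (p - 1)) = ((size h).-1 * (p - 1)).+1.
  by rewrite -size_exp prednK // size_poly_gt0 expf_neq0.
apply: (H (h ^+ (p - 1)) (h ^+ (p - 1) * (g - c *: h)) v) => //.
- rewrite size_mul ?expf_neq0 //; last by rewrite -size_poly_gt0 szgc; lia.
  by rewrite shp szgc /D; case: (size g) hgh => //= n; lia.
- rewrite shp /D /=; have [q ep] : exists q, p = q.+2 by exists p.-2; lia.
  have : ((size h).-1 < (size g).-1)%N by lia.
  rewrite ep subn1 /=; move: (size h).-1 (size g).-1 => a b hab.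
  have : (a * q.+1 < q.+1 * b)%N by rewrite [(q.+1 * b)%N]mulnC ltn_mul2r.
  by nia.
move=> z /hZ[vz ez hz ehz tr]; split=> //; split=> //.
have [ys [uys sys hys]] := artin_schreier_roots (g.[z] / h.[z] - c) hp.
exists [seq h.[z] * y | y <- ys]; split; first by rewrite map_inj_uniq //; apply: mulfI.
split; first by rewrite size_map.
move=> _ /mapP[y /hys hy ->]; split.
  have hp1 : h.[z] ^+ p = h.[z] ^+ (p - 1) * h.[z] by rewrite -exprSr subn1 prednK // ltnW.
  rewrite exprMn hp1 !(hornerE, horner_exp); apply/eqP; rewrite -subr_eq0; apply/eqP.
  transitivity (h.[z] ^+ (p - 1) * h.[z] * (y ^+ p - y - (g.[z] / h.[z] - c))).
    by move: (h.[z] ^+ (p - 1)) (y ^+ p) => a b; rewrite /=; field.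
  by rewrite hy subrr mulr0.
rewrite exprMn mulrA ehz; congr (_ * _).
apply/eqP; rewrite -subr_eq0 -artin_schreier_tele // hy.
exact/eqP.
Qed.

Definition frob_trace (K : fieldType) (p m : nat) (x : K) : K := \sum_(i < m) x ^+ (p ^ i).

Definition trace_count_bound (K : fieldType) (p : nat) (g h : {poly K}) : Prop :=
  exists C N0 : nat, forall (c : K) (mu nu : nat) (Z : seq K),
  (N0 <= mu <= nu)%N -> uniq Z ->
  (forall x, x \in Z ->
     [/\ x ^+ (p ^ (mu + nu)) = x, h.[x] != 0, h.[x] ^+ (p ^ (mu + nu)) = h.[x] &
         frob_trace p (mu + nu) (g.[x] / h.[x] - c) = 0]) ->
  (p * size Z <= p ^ (mu + nu) + C * p ^ nu)%N.

Lemma trace_count_infinity (K : closedFieldType) p (g h : {poly K}) :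
  p \in [pchar K] -> h != 0 -> (size h < size g)%N -> ~~ (p %| size g - size h)%N ->
  trace_count_bound p g h.
Proof.
move=> hp h0 hgh pd; have [C [N0 H]] := artin_schreier_count 0 hp h0 hgh pd.
exists C, N0 => c mu nu Z hmu uZ hZ; apply: (H c 1) => //.
  by rewrite size_poly1.
by move=> x /hZ[ex hx ehx tr]; split; rewrite ?hornerC ?oner_eq0 ?mul1r.
Qed.

(* z^m g(rho + 1/z), for m >= deg g. *)
Definition invert_at (K : fieldType) (rho : K) (m : nat) (g : {poly K}) : {poly K} :=
  \poly_(i < m.+1) (g \Po ('X + rho%:P))`_(m - i).

Lemma size_shift (K : fieldType) (rho : K) (g : {poly K}) :
  size (g \Po ('X + rho%:P)) = size g.
Proof.
have s2 : size ('X + rho%:P) = 2%N by rewrite size_XaddC.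
by rewrite size_comp_poly2.
Qed.

Lemma horner_invert_at (K : fieldType) (rho x : K) m (g : {poly K}) :
  (size g <= m.+1)%N -> x != rho ->
  (invert_at rho m g).[(x - rho)^-1] = ((x - rho)^-1) ^+ m * g.[x].
Proof.
move=> sg xr; have nz : x - rho != 0 by rewrite subr_eq0.
have -> : g.[x] = (g \Po ('X + rho%:P)).[x - rho].
  by rewrite horner_comp !hornerE subrK.
rewrite [in RHS](@horner_coef_wide _ m.+1) ?size_shift // mulr_sumr horner_poly.
rewrite (reindex_inj rev_ord_inj) /=; apply: eq_bigr => i _.
rewrite subSS subKn ?(leq_ord i) // mulrCA; congr (_ * _).
have := leq_ord i; move: (nat_of_ord i) => k km.
by rewrite -{2}(subnK km) exprD -mulrA -exprMn mulVf // expr1n mulr1.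
Qed.

Lemma trace_count_pole (K : closedFieldType) p (g h h1 : {poly K}) (rho : K) e :
  p \in [pchar K] -> h = ('X - rho%:P) ^+ e * h1 -> h1.[rho] != 0 -> g.[rho] != 0 ->
  (0 < e)%N -> ~~ (p %| e)%N -> trace_count_bound p g h.
Proof.
move=> hp eh h1r gr e0 pe.
have h10 : h1 != 0 by apply: contraNneq h1r => ->; rewrite horner0.
have h0 : h != 0 by rewrite eh mulf_neq0 ?expf_neq0 ?polyXsubC_eq0.
pose m := (maxn (size g) (size h)).-1.
have sg0 : (0 < size g)%N.
  by rewrite size_poly_gt0; apply: contraNneq gr => ->; rewrite horner0.
have sgm : (size g <= m.+1)%N by rewrite /m prednK ?leq_maxl // leq_max sg0.
have shm : (size h <= m.+1)%N by rewrite /m prednK ?leq_maxr // leq_max sg0.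
have em : (e <= m)%N.
  rewrite -ltnS; apply: leq_trans shm.
  rewrite eh mulrC size_Mmonic ?monic_exp ?monicXsubC // size_exp_XsubC addnS /=.
  by rewrite -[e.+1]add1n leq_add2r size_poly_gt0.
have coef_shift0 q : (q \Po ('X + rho%:P))`_0 = q.[rho].
  by rewrite -horner_coef0 horner_comp !hornerE ?add0r.
have shift_h : h \Po ('X + rho%:P) = (h1 \Po ('X + rho%:P)) * 'X^e.
  by rewrite eh comp_polyM rmorphXn /= comp_polyB comp_polyX comp_polyC addrK mulrC.
pose g' := invert_at rho m g; pose h' := invert_at rho m h.
have sg' : size g' = m.+1 by rewrite size_poly_eq // subnn coef_shift0.
have h'_lead : h'`_(m - e) != 0.
  by rewrite coef_poly ltnS leq_subr subKn // shift_h coefMXn ltnn subnn coef_shift0.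
have sh' : size h' = (m - e).+1.
  apply/eqP; rewrite eqn_leq; apply/andP; split; last first.
    by rewrite ltnNge; apply: contra h'_lead => /leq_sizeP ->.
  apply/leq_sizeP => j hj; rewrite coef_poly; case: ifP => // jm.
  by rewrite shift_h coefMXn ifT //; lia.
have h'0 : h' != 0 by rewrite -size_poly_gt0 sh'.
have [||C [N0 H]] := artin_schreier_count m hp h'0 (_ : (size h' < size g')%N)
    (_ : ~~ (p %| size g' - size h')%N).
- by rewrite sg' sh'; lia.
- by rewrite sg' sh' subSS subKn.
exists C, N0 => c mu nu Z hmu uZ hZ.
set Q := (p ^ (mu + nu))%N in hZ *.
have Zr x : x \in Z -> x != rho.
  case/hZ=> _ hx _ _; apply: contraNneq hx => ->.
  by rewrite eh hornerM horner_exp !hornerE subrr expr0n gtn_eqF ?mul0r.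
pose v := 1 + (rho - rho ^+ Q) *: 'X.
have vE x : x \in Z -> v.[(x - rho)^-1] = (x - rho)^-1 * (x - rho) ^+ Q.
  move=> xZ; have [ex _ _ _] := hZ x xZ; rewrite pchar_exprB // ex !hornerE.
  by field; rewrite subr_eq0 Zr.
rewrite -(size_map (fun x => (x - rho)^-1)).
apply: (H c v) => //.
- apply: leq_trans (size_polyD _ _) _; rewrite geq_max size_poly1 /=.
  by apply: leq_trans (size_scale_leq _ _) _; rewrite size_polyX.
- by rewrite map_inj_uniq // => x y /invr_inj /addIr.
move=> _ /mapP[x xZ ->]; have [ex hx ehx tr] := hZ x xZ.
have nz : x - rho != 0 by rewrite subr_eq0 Zr.
rewrite vE // -/Q !horner_invert_at ?Zr //.
split.
- by rewrite mulf_neq0 ?invr_eq0 ?expf_neq0.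
- by rewrite -mulrA -exprMn mulfV // expr1n mulr1.
- by rewrite mulf_neq0 // expf_neq0 // invr_eq0.
- have e1 : ((x - rho) ^+ Q) ^+ m * ((x - rho)^-1 ^+ m) ^+ Q = 1.
    by rewrite -!exprM [(Q * m)%N]mulnC -exprMn mulfV // expr1n.
  rewrite exprMn [X in _ * X]exprMn ehx mulrA; congr (_ * _).
  by rewrite -mulrA e1 mulr1.
- rewrite -[RHS]tr /frob_trace; apply: eq_bigr => i _; congr ((_ - c) ^+ _).
  by rewrite -mulf_div divff ?mul1r // expf_neq0 // invr_eq0.
Qed.

(** * Reduction of poles modulo G^p - G *)

Lemma finField_pth_root (L : finFieldType) p (x : L) :
  p \in [pchar L] -> exists y : L, y ^+ p = x.
Proof.
move=> hp; have [g _ gK] := injF_bij (fmorph_inj (pFrobenius_aut hp)).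
by exists (g x); rewrite -(pFrobenius_autE hp) gK.
Qed.

Lemma monic_irreducible_factor (F : fieldType) (h : {poly F}) : (1 < size h)%N ->
  exists P : {poly F}, [/\ irreducible_poly P, P \is monic & P %| h].
Proof.
move: {2}(size h) (leqnn (size h)) => n; elim: n h => [|n IH] h.
  by rewrite leqn0 => /eqP ->.
move=> hn h1; have h0 : h != 0 by rewrite -size_poly_gt0 ltnW.
have [[d]|nd] := EM (exists d : {poly F}, [/\ (1 < size d)%N, (size d < size h)%N & d %| h]).
  case=> d1 dh dvd; have [|P [iP mP Pd]] := IH d _ d1.
    by rewrite -ltnS; apply: leq_trans hn.
  by exists P; split=> //; apply: dvdp_trans dvd.
have lu : (lead_coef h)^-1 != 0 by rewrite invr_eq0 lead_coef_eq0.
exists ((lead_coef h)^-1 *: h); split; last by rewrite dvdpZl.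
  split; first by rewrite size_scale.
  move=> d d1; rewrite dvdpZr // => dvd; rewrite (eqp_rtrans (eqp_scale _ lu)).
  rewrite -dvdp_size_eqp //; have := dvdp_leq h0 dvd; rewrite leq_eqVlt => /orP[//|dh].
  case: nd; exists d; split=> //; rewrite ltn_neqAle eq_sym d1 /= size_poly_gt0.
  by apply: contraTneq dvd => ->; rewrite dvd0p.
by rewrite monicE lead_coefZ mulVf // lead_coef_eq0.
Qed.

Lemma irreducible_power_factor (F : fieldType) (P h : {poly F}) :
  irreducible_poly P -> h != 0 -> exists e h1, h = P ^+ e * h1 /\ ~~ (P %| h1).
Proof.
move=> iP; move: {2}(size h) (leqnn (size h)) => n; elim: n h => [|n IH] h.
  by rewrite leqn0 size_poly_eq0 => ->.
move=> hn h0; have [/dvdpP[q eq]|nd] := boolP (P %| h); last first.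
  by exists 0%N, h; rewrite expr0 mul1r.
have q0 : q != 0 by apply: contraNneq h0 => q0; rewrite eq q0 mul0r.
have [|e [h1 [eh1 nd]]] := IH q _ q0.
  rewrite -ltnS; apply: leq_trans hn; rewrite eq size_mul // ?irredp_neq0 //.
  by move: iP.1 (size_poly_gt0 q); rewrite q0; move: (size P) (size q); lia.
by exists e.+1, h1; rewrite eq eh1 exprSr mulrAC.
Qed.

Definition good_pole (F : fieldType) (p : nat) (g h : {poly F}) : Prop :=
  ((size h < size g)%N /\ ~~ (p %| size g - size h)%N) \/
  (exists (P : {poly F}) (e : nat) (h1 : {poly F}),
     [/\ irreducible_poly P /\ P \is monic, h = P ^+ e * h1, ~~ (P %| h1), ~~ (P %| g) &
         (0 < e)%N && ~~ (p %| e)%N]).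

Lemma in_qpoly_eq0 (F : fieldType) (P g : {poly F}) (mi : monic_irreducible_poly P) :
  (in_qpoly P g == 0) = (P %| g).
Proof.
rewrite -val_eqE /= (mk_monicE mi) /dvdp.
by rewrite (Pdiv.IdomainMonic.modpE mi.2).
Qed.

Lemma pth_root_mod (F : finFieldType) p (P g h : {poly F}) : p \in [pchar F] ->
  irreducible_poly P -> P \is monic -> ~~ (P %| h) ->
  exists C : {poly F}, (size C < size P)%N /\ P %| g - C ^+ p * h.
Proof.
move=> hp iP mP nPh; pose mi : monic_irreducible_poly P := (iP, mP).
pose L := {poly %/ P with mi}.
have hpL : p \in [pchar L] by rewrite pchar_qpoly.
have [y hy] := finField_pth_root ((in_qpoly P g : L) / (in_qpoly P h : L)) hpL.
exists (val y); split.
  by rewrite -[in X in (_ < X)%N](mk_monicE mi); apply: size_mk_monic.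
have vy : in_qpoly P (val y) = y.
  by apply/val_inj; apply: in_qpoly_small; apply: size_mk_monic.
have h0 : (in_qpoly P h : L) != 0 by rewrite in_qpoly_eq0.
rewrite -(in_qpoly_eq0 _ mi) rmorphB rmorphM rmorphXn /= vy.
have e1 : (in_qpoly P g : L) - y ^+ p * in_qpoly P h = 0.
  by rewrite hy divfK // subrr.
by apply/eqP; exact: e1.
Qed.


Lemma as_step (K : fieldType) (g h Gp G : K) : h != 0 ->
  g / h - (g - Gp * h + G * h) / h = Gp - G.
Proof. by move=> h0; field. Qed.

Lemma leq_pred_add a b c s : (a <= b.+1 -> b <= c -> 0 < s -> (a + s).-1 <= c + s)%N.
Proof. by lia. Qed.

Lemma leq_pred_add3 c d s t u : (c <= d -> t + d <= u -> (c + (t + s)).-1 <= u + s)%N.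
Proof. by lia. Qed.

Lemma as_step_pole (R : comNzRingType) (K : fieldType) (phi : {rmorphism R -> K})
    (P h1 C g g' : R) (e m p : nat) :
  phi P != 0 -> phi h1 != 0 -> (e <= e * p)%N -> (e * p = m.+1)%N ->
  g - C ^+ p * h1 + C * P ^+ (e * p - e) * h1 = g' * P ->
  phi g / phi (P ^+ (e * p) * h1) - phi g' / phi (P ^+ m * h1) =
  (phi C / phi P ^+ e) ^+ p - phi C / phi P ^+ e.
Proof.
move=> P0 h0 le_e em eg.
have -> : phi g' / phi (P ^+ m * h1) = phi (g' * P) / phi (P ^+ (e * p) * h1).
  rewrite em exprSr mulrAC [in RHS]rmorphM [in RHS](rmorphM _ (P ^+ m * h1)).
  by rewrite -mulf_div divff ?mulr1.
have h'0 : phi (P ^+ (e * p) * h1) != 0 by rewrite rmorphM rmorphXn mulf_neq0 ?expf_neq0.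
have eG : (phi C / phi P ^+ e) * phi (P ^+ (e * p) * h1) = phi (C * P ^+ (e * p - e) * h1).
  rewrite !rmorphM !rmorphXn /= -{1}(subnKC le_e).
  by rewrite exprD -!mulrA; congr (_ * _); rewrite mulKf // expf_neq0.
have eGp : (phi C / phi P ^+ e) ^+ p * phi (P ^+ (e * p) * h1) = phi (C ^+ p * h1).
  rewrite !rmorphM !rmorphXn exprMn /= -!mulrA; congr (_ * _).
  by rewrite exprVn -exprM mulKf // expf_neq0.
rewrite -eg rmorphD rmorphB -eG -eGp.
exact: as_step.
Qed.

Lemma frac_cancel (R : comNzRingType) (K : fieldType) (phi : {rmorphism R -> K}) a b c :
  phi c != 0 -> phi (a * c) / phi (b * c) = phi a / phi b.
Proof. by move=> c0; rewrite !rmorphM -mulf_div divff ?mulr1. Qed.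

Lemma ltn_pred_add a b : (0 < a -> 1 < b -> a < (a + b).-1)%N.
Proof. by lia. Qed.

Lemma measure_cancel a b a' b' n : (b + maxn a b <= n.+1 -> b' < b -> a' < a ->
  b' + maxn a' b' <= n)%N.
Proof. by lia. Qed.

Lemma measure_infinity a b a' n : (b + maxn a b <= n.+1 -> a' < a -> b < a ->
  b + maxn a' b <= n)%N.
Proof. by lia. Qed.

Lemma measure_pole a b a' b' n : (b + maxn a b <= n.+1 -> b' < b ->
  maxn a' b' <= maxn a b -> b' + maxn a' b' <= n)%N.
Proof. by lia. Qed.

Section PoleReduction.
Variables (F : finFieldType) (p : nat).
Hypothesis hp : p \in [pchar F].
Implicit Types g h : {poly F}.

Local Notation "x %:F" := (@FracField.tofrac _ x).
Local Notation k := {fraction {poly F}}.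

Let pp : prime p := pcharf_prime hp.
Let p0 : (0 < p)%N := prime_gt0 pp.

Let pchar_frac : p \in [pchar k].
Proof. by rewrite (rmorph_pchar (@FracField.tofrac _)) // pchar_poly. Qed.

Definition as_equiv (f f' : k) : Prop := exists G : k, f - f' = G ^+ p - G.

Lemma as_equiv_trans f f' f'' : as_equiv f f' -> as_equiv f' f'' -> as_equiv f f''.
Proof.
case=> G hG [G' hG']; exists (G + G').
rewrite -(expn1 p) pchar_exprD // expn1 -[f](subrK f') -addrA.
by rewrite hG hG'; ring.
Qed.

Lemma reduce_infinity g h : h != 0 -> (size h < size g)%N -> (p %| size g - size h)%N ->
  exists2 g' : {poly F}, (size g' < size g)%N & as_equiv (g%:F / h%:F) (g'%:F / h%:F).
Proof.
move=> h0 hgh /dvdnP[e he].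
have hF : h%:F != 0 by rewrite tofrac_eq0.
have e0 : (0 < e)%N by case: e he => // he; lia.
have [c hc] := finField_pth_root (lead_coef g / lead_coef h) hp.
pose G := c *: 'X^e : {poly F}.
exists (g - G ^+ p * h + G * h); last first.
  exists G%:F; rewrite tofracD tofracB !tofracM tofracXn.
  exact: as_step.
have lh0 : lead_coef h != 0 by rewrite lead_coef_eq0.
have g0 : (0 < size g)%N by apply: leq_ltn_trans hgh.
have c0 : c != 0.
  apply/eqP => c0; move/esym/eqP: hc; rewrite c0 expr0n gtn_eqF //.
  by rewrite mulf_eq0 invr_eq0 (negPf lh0) orbF lead_coef_eq0 -size_poly_eq0 gtn_eqF.
have eGp : G ^+ p = (c ^+ p) *: 'X^(e * p) by rewrite exprZn -exprM.
have sGp : size (G ^+ p * h) = size g.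
  rewrite eGp -scalerAl size_scale ?expf_neq0 // mulrC size_mulXn //.
  by rewrite -he subnK // ltnW.
have lGp : lead_coef (G ^+ p * h) = lead_coef g.
  by rewrite eGp lead_coefM lead_coefZ lead_coefXn mulr1 hc divfK.
rewrite -(prednK g0) ltnS; apply: leq_trans (size_polyD _ _) _.
rewrite geq_max; apply/andP; split.
  apply/leq_sizeP => j; rewrite leq_eqVlt => /predU1P[<-|hj].
    by rewrite coefB -{2}sGp -!lead_coefE lGp subrr.
  have sj : (size g <= j)%N by rewrite -(prednK g0).
  by rewrite coefB !nth_default ?subrr ?sGp.
rewrite /G -scalerAl; apply: leq_trans (size_scale_leq _ _) _.
rewrite mulrC size_mulXn // -ltnS prednK // addnC -ltn_subRL he.
by rewrite ltn_Pmulr ?prime_gt1.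
Qed.

Lemma reduce_pole (P h1 : {poly F}) (e : nat) g h :
  irreducible_poly P -> P \is monic -> h = P ^+ (e * p) * h1 -> ~~ (P %| h1) ->
  (0 < e)%N -> h != 0 ->
  exists g' h' : {poly F}, [/\ h' != 0, (size h' < size h)%N,
    (maxn (size g') (size h') <= maxn (size g) (size h))%N &
    as_equiv (g%:F / h%:F) (g'%:F / h'%:F)].
Proof.
move=> iP mP eh nP e0 h0.
have [C [sC dC]] := pth_root_mod g hp iP mP nP.
have [e' ee] : exists e', (e * p - e = e'.+1)%N.
  by exists (e * p - e).-1; have := prime_gt1 pp; nia.
have [m em] : exists m, (e * p = m.+1)%N by exists (e * p).-1; nia.
have /dvdpP[g' eg'] : P %| g - C ^+ p * h1 + C * P ^+ (e * p - e) * h1.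
  apply: dvdp_add => //; rewrite ee exprS -mulrA mulrCA -mulrA; exact: dvdp_mulr.
have P0 := irredp_neq0 iP; have h10 : h1 != 0 by apply: contraNneq nP => ->; rewrite dvdp0.
pose d := (size P).-1; have sP : size P = d.+1 by rewrite prednK // size_poly_gt0.
have d0 : (0 < d)%N by have := iP.1; rewrite sP.
have sPn n : size (P ^+ n * h1) = (n * d + size h1)%N.
  have -> : size (P ^+ n * h1) = (size (P ^+ n) + size h1).-1.
    by rewrite size_mul ?expf_neq0.
  have -> : size (P ^+ n) = (n * d).+1.
    by rewrite mulnC -size_exp prednK // size_poly_gt0 expf_neq0.
  by [].
have sh1 : (0 < size h1)%N by rewrite size_poly_gt0.
have hh' : h = (P ^+ m * h1) * P by rewrite eh em exprSr mulrAC.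
have h'0 : P ^+ m * h1 != 0 by rewrite mulf_neq0 ?expf_neq0.
exists g', (P ^+ m * h1); split=> //.
- by rewrite eh !sPn em ltn_add2r ltn_mul2r d0 ltnS leqnn.
- rewrite geq_max; apply/andP; split; last first.
    by rewrite leq_max eh !sPn em leq_add2r leq_mul2r leqnSn !orbT.
  have [->|g'0] := eqVneq g' 0; first by rewrite size_poly0.
  have : (size g' <= size (g' * P)%R)%N.
    by rewrite size_mul // sP addnS /= leq_addr.
  move/leq_trans; apply; rewrite -eg'.
  apply: leq_trans (size_polyD _ _) _; rewrite geq_max; apply/andP; split.
    apply: leq_trans (size_polyD _ _) _; rewrite geq_max leq_maxl size_polyN /=.
    rewrite leq_max; apply/orP; right.
    apply: leq_trans (size_polyMleq _ _) _.
    have h2 := size_poly_exp_leq C p.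
    have h3 : ((size C).-1 * p <= d * (e * p))%N.
      apply: leq_mul; last exact: leq_pmull.
      by rewrite -ltnS -sP; apply: leq_ltn_trans (leq_pred _) sC.
    have -> : size h = (d * (e * p) + size h1)%N by rewrite eh sPn mulnC.
    exact: leq_pred_add h2 h3 sh1.
  rewrite leq_max; apply/orP; right; rewrite -mulrA.
  apply: leq_trans (size_polyMleq _ _) _; rewrite sPn eh sPn.
  have h3 : ((e * p - e) * d + d <= e * p * d)%N.
    by rewrite -mulSnr leq_mul2r ltn_subrL e0 muln_gt0 e0 p0 orbT.
  by apply: leq_pred_add3 h3; rewrite -ltnS -sP.
exists (C%:F / P%:F ^+ e); rewrite eh.
by apply: (as_step_pole _ _ _ em eg'); rewrite ?tofrac_eq0 ?leq_pmulr.
Qed.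

Lemma reduce_poles g h : h != 0 ->
  (exists c : F, as_equiv (g%:F / h%:F) (c%:P)%:F) \/
  (exists g' h' : {poly F}, [/\ h' != 0, good_pole p g' h' &
     as_equiv (g%:F / h%:F) (g'%:F / h'%:F)]).
Proof.
have refl f : as_equiv f f by exists 0; rewrite expr0n gtn_eqF // !subrr.
move: {2}(size h + maxn (size g) (size h))%N
  (leqnn (size h + maxn (size g) (size h))%N) => n.
elim: n g h => [|n IH] g h.
  by rewrite leqn0 addn_eq0 size_poly_eq0 => /andP[/eqP->]; rewrite eqxx.
move=> hn h0.
have step g' h' : h' != 0 -> (size h' + maxn (size g') (size h') <= n)%N ->
    as_equiv (g%:F / h%:F) (g'%:F / h'%:F) ->
    (exists c : F, as_equiv (g%:F / h%:F) (c%:P)%:F) \/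
    (exists g' h' : {poly F}, [/\ h' != 0, good_pole p g' h' &
     as_equiv (g%:F / h%:F) (g'%:F / h'%:F)]).
  move=> h'0 sz eqv; case: (IH g' h' sz h'0) => [[c hc]|[g1 [h1 [h10 gp eqv1]]]].
    by left; exists c; apply: as_equiv_trans eqv hc.
  by right; exists g1, h1; split=> //; apply: as_equiv_trans eqv eqv1.
have [g0|g0] := eqVneq g 0.
  by left; exists 0; rewrite g0 polyC0 !rmorph0 mul0r.
have sh0 : (0 < size h)%N by rewrite size_poly_gt0.
have [cp|ncp] := boolP (coprimep g h); last first.
  have [d sd [dg dh]] : exists2 d : {poly F}, (1 < size d)%N & d %| g /\ d %| h.
    exists (gcdp g h); last by rewrite dvdp_gcdl dvdp_gcdr.
    by rewrite ltn_neqAle eq_sym -/(coprimep g h) ncp size_poly_gt0 gcdp_eq0 negb_and g0.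
  case/dvdpP: dg => g' eg; case/dvdpP: dh => h' eh.
  have d0 : d != 0 by rewrite -size_poly_gt0 ltnW.
  have g'0 : g' != 0 by apply: contraNneq g0 => g'0; rewrite eg g'0 mul0r.
  have h'0 : h' != 0 by apply: contraNneq h0 => h'0; rewrite eh h'0 mul0r.
  have shrink (u : {poly F}) : u != 0 -> (size u < size (u * d)%R)%N.
    move=> u0; rewrite size_mul //; move: sd; rewrite -size_poly_gt0 in u0.
    by move: u0; exact: ltn_pred_add.
  apply: (step g' h' h'0); last first.
    have -> : g%:F / h%:F = g'%:F / h'%:F by rewrite eg eh frac_cancel ?tofrac_eq0.
    exact: refl.
  have := shrink g' g'0; have := shrink h' h'0; rewrite -eg -eh.
  by move: hn; exact: measure_cancel.
have [hgh|hgh] := ltnP (size h) (size g).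
  have [dv|ndv] := boolP (p %| size g - size h)%N; last first.
    by right; exists g, h; split=> //; left.
  have [g' sg' eqv] := reduce_infinity h0 hgh dv.
  apply: (step g' h h0) eqv; move: hn sg' hgh; exact: measure_infinity.
have [sh1|sh1] := leqP (size h) 1.
  have /size_poly1P[b b0 eb] : size h == 1%N by rewrite eqn_leq sh1.
  have /size1_polyC ea := leq_trans hgh sh1.
  left; exists (g`_0 / b); rewrite eb {1}ea.
  have -> : (g`_0)%:P%:F / b%:P%:F = (g`_0 / b)%:P%:F :> k.
    rewrite -{1}(divfK b0 g`_0) (polyCM (g`_0 / b) b) tofracM.
    by rewrite mulfK // tofrac_eq0 polyC_eq0.
  exact: refl.
have [P [iP mP Ph]] := monic_irreducible_factor sh1.
have [e [h1 [eh nP]]] := irreducible_power_factor iP h0.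
have e0 : (0 < e)%N.
  by rewrite lt0n; apply: contraNneq nP => e0; rewrite eh e0 expr0 mul1r in Ph.
have nPg : ~~ (P %| g).
  rewrite -(irreducible_poly_coprime g iP); apply: coprimep_dvdr Ph _.
  by rewrite coprimep_sym.
have [/dvdnP[e' ee]|pe] := boolP (p %| e)%N; last first.
  by right; exists g, h; split=> //; right; exists P, e, h1; split=> //; rewrite e0.
have e'0 : (0 < e')%N by case: e' ee => // ee; rewrite ee in e0.
rewrite ee in eh.
have [g' [h' [h'0 sh' mx eqv]]] := reduce_pole g iP mP eh nP e'0 h0.
by apply: (step g' h' h'0) eqv; move: hn sh' mx; exact: measure_pole.
Qed.
End PoleReduction.

Local Open Scope quotient_scope.

Lemma ratfun_reprE (R : idomainType) (D : {fraction R}) :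
  D = FracField.tofrac (repr D).1 / FracField.tofrac (repr D).2.
Proof.
have d0 : (repr D).2 != 0 := denom_ratioP _.
apply: (canRL (mulfK _)); first by rewrite tofrac_eq0.
suff E x : \pi_(FracField.type R) x * FracField.tofrac x.2 = FracField.tofrac x.1.
  by rewrite -[X in X * _](reprK D) E.
rewrite -[_ * _]/(FracField.mul _ _) !piE; apply/eqmodP => /=.
rewrite FracField.equivfE /FracField.mulf !numden_Ratio ?mulr1 ?oner_eq0 ?denom_ratioP //.
by rewrite mulrC.
Qed.
Local Close Scope quotient_scope.

Lemma multp_eq (F : fieldType) (P f1 : {poly F}) e : irreducible_poly P ->
  f1 != 0 -> ~~ (P %| f1) -> multp P (P ^+ e * f1) = e.
Proof.
move=> iP f10 nP; have P0 := irredp_neq0 iP.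
have e_small : (e < size (P ^+ e * f1)%R)%N.
  rewrite size_mul ?expf_neq0 //.
  have h1 : (e < size (P ^+ e))%N.
    have := size_exp P e; have := size_poly_gt0 (P ^+ e); rewrite expf_neq0 //.
    have : (e <= (size P).-1 * e)%N by rewrite leq_pmull // -subn1 subn_gt0 iP.1.
    by move: (_ * e)%N (size (P ^+ e)); lia.
  have : (0 < size f1)%N by rewrite size_poly_gt0.
  by move: h1; move: (size (P ^+ e)) (size f1); lia.
apply/eqP; rewrite eqn_leq; apply/andP; split.
  apply/bigmax_leqP => i; apply: contraTT; rewrite -ltnNge => ei.
  apply: contra nP => dv; rewrite -(dvdp_mul2l _ _ (expf_neq0 e P0)).
  by rewrite -exprSr; apply: dvdp_trans dv; apply: dvdp_exp2l.
by apply: (leq_bigmax_cond (Ordinal e_small)); rewrite /= dvdp_mulr.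
Qed.

Section ReducedFraction.
Variables (F : fieldType) (D : ratfun F).
Local Notation "x %:F" := (@FracField.tofrac _ x).

Definition rnum : {poly F} := (repr D).1 %/ gcdp (repr D).1 (repr D).2.
Definition rden : {poly F} := (repr D).2 %/ gcdp (repr D).1 (repr D).2.

Let d0 : (repr D).2 != 0 := denom_ratioP _.
Let g0 : gcdp (repr D).1 (repr D).2 != 0.
Proof. by rewrite gcdp_eq0 negb_and d0 orbT. Qed.

Lemma rnumE : rnum * gcdp (repr D).1 (repr D).2 = (repr D).1.
Proof. by rewrite divpK ?dvdp_gcdl. Qed.

Lemma rdenE : rden * gcdp (repr D).1 (repr D).2 = (repr D).2.
Proof. by rewrite divpK ?dvdp_gcdr. Qed.

Lemma rden_neq0 : rden != 0.
Proof. by apply: contraNneq d0 => h; rewrite -rdenE h mul0r. Qed.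

Lemma coprimep_rnum_rden : coprimep rnum rden.
Proof. by apply: coprimep_div_gcd; rewrite d0 orbT. Qed.

Lemma rnum_rdenE : D = rnum%:F / rden%:F.
Proof.
rewrite -(@frac_cancel _ _ (@FracField.tofrac _) rnum rden (gcdp (repr D).1 (repr D).2)).
  by rewrite /= rnumE rdenE; exact: ratfun_reprE.
by rewrite tofrac_eq0.
Qed.

Lemma ord_at_ge0 (P : {poly F}) : irreducible_poly P -> D != 0 ->
  (0 <= ord_at P D)%E = ~~ (P %| rden).
Proof.
move=> iP D0; rewrite /ord_at (negPf D0) lee_fin subr_ge0 lez_nat.
have n0 : rnum != 0.
  by apply: contraNneq D0 => h; rewrite [D]rnum_rdenE h tofrac0 mul0r.
have [a [c [ec nc]]] := irreducible_power_factor iP g0.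
have [b [u [eu nu]]] := irreducible_power_factor iP n0.
have [b' [w [ew nw]]] := irreducible_power_factor iP rden_neq0.
have c0 : c != 0 by apply: contraNneq g0 => h; rewrite ec h mulr0.
have u0 : u != 0 by apply: contraNneq n0 => h; rewrite eu h mulr0.
have w0 : w != 0 by apply: contraNneq rden_neq0 => h; rewrite ew h mulr0.
have mulN s t : ~~ (P %| s) -> ~~ (P %| t) -> ~~ (P %| s * t).
  by rewrite -!(irreducible_poly_coprime _ iP) coprimepMr => -> ->.
have -> : multp P (repr D).1 = (b + a)%N.
  rewrite -rnumE ec {1}eu mulrACA -exprD multp_eq ?mulf_neq0 //.
  exact: mulN.
have -> : multp P (repr D).2 = (b' + a)%N.
  rewrite -rdenE ec {1}ew mulrACA -exprD multp_eq ?mulf_neq0 //.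
  exact: mulN.
rewrite leq_add2r.
have := coprimep_rnum_rden; rewrite eu ew.
case: b' {ew} => [|b'] cp; first by rewrite expr0 mul1r nw.
rewrite [in RHS]exprS -mulrA dvdp_mulr //=.
case: b eu cp => [//|b] eu cp; exfalso.
have := iP.1; suff : size P == 1%N by move/eqP->.
by have /coprimepP/(_ P) := cp; rewrite -size_poly_eq1 !exprS -!mulrA !dvdp_mulr // => ->.
Qed.

End ReducedFraction.

(** * Traces and Hasse symbols *)

Lemma card_finField_pchar (F : finFieldType) p (hp : p \in [pchar F]) :
  #|F| = (p ^ logn p #|F|)%N.
Proof. exact: (card_pprimeChar hp). Qed.

Section Trace.
Variables (F : finFieldType) (A : falgType F) (K : fieldType).
Variables (iota : {rmorphism F -> K}) (sigma : {rmorphism A -> K}).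
Hypothesis sigmaC : forall c : F, sigma c%:A = iota c.
Hypothesis sigma_inj : injective sigma.

Local Notation q := #|F|.
Local Notation n := (\dim {:A}).
Local Notation e := (vbasis {:A}).

Let e_basis : basis_of {:A} e := vbasisP _.

Let q1 : (1 < q)%N := finNzRing_gt1 F.

Lemma frob_iota (c : F) k : iota c ^+ (q ^ k) = iota c.
Proof.
elim: k => [|k IH]; first by rewrite expn0 expr1.
by rewrite expnSr exprM IH -rmorphXn expf_card.
Qed.

Lemma frob_card_sum (I : Type) (r : seq I) (E : I -> K) k :
  (\sum_(i <- r) E i) ^+ (q ^ k) = \sum_(i <- r) E i ^+ (q ^ k).
Proof.
have [p hp] : exists p, p \in [pchar F].
  by have [p _ hp] := finPcharP F; exists p.
by rewrite (card_finField_pchar hp) -expnM pchar_expr_sum // (rmorph_pchar iota).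
Qed.

(* V diagonalises the multiplication by any element of A. *)
Let V : 'M[K]_n := \matrix_(j, k) (sigma e`_j) ^+ (q ^ k).

Let sigma_vecof (u : 'rV[F]_n) : sigma (passmx.vecof e u) = \sum_i iota (u 0 i) * sigma e`_i.
Proof.
rewrite /passmx.vecof rmorph_sum; apply: eq_bigr => i _.
by rewrite -mulr_algl rmorphM sigmaC.
Qed.

Let unit_V : V \in unitmx.
Proof.
rewrite -unitmx_tr -row_free_unit -kermx_eq0; apply/negPn/negP.
case/rowV0Pn => c /sub_kermxP hc /eqP; case.
pose f : {poly K} := \sum_(k < n) c 0 k *: 'X^(q ^ k).
have f0 : f = 0.
  apply: (roots_geq_poly_eq0 (rs := [seq sigma (passmx.vecof e u) | u : 'rV[F]_n])).
  - apply/allP => _ /mapP[u _ ->]; rewrite /root horner_sum.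
    under eq_bigr do rewrite hornerZ hornerXn sigma_vecof frob_card_sum mulr_sumr.
    rewrite exchange_big big1 //= => j _.
    under eq_bigr do rewrite exprMn frob_iota mulrCA.
    rewrite -mulr_sumr; have := congr1 (fun w : 'rV_n => w 0 j) hc.
    rewrite !mxE; under eq_bigr do rewrite !mxE.
    by move=> ->; rewrite mulr0.
  - rewrite map_inj_uniq ?enum_uniq //; apply: inj_comp sigma_inj _.
    exact: can_inj (passmx.vecofK e_basis).
  - rewrite size_map -cardE card_mx mul1n.
    apply: leq_trans (size_sum _ _ _) _; apply/bigmax_leqP => k _.
    apply: leq_trans (size_scale_leq _ _) _.
    by rewrite size_polyXn ltn_exp2l.
apply/rowP => k; have := congr1 (fun g : {poly K} => g`_(q ^ k)) f0.
rewrite coef_sum coef0 (bigD1 k) //= coefZ coefXn eqxx mulr1 big1 ?addr0 ?mxE // => j nj.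
by rewrite coefZ coefXn eqn_exp2l // eq_sym (inj_eq val_inj) (negPf nj) mulr0.
Qed.

Lemma alg_trace_frob (a : A) : iota (alg_trace a) = \sum_(k < n) sigma a ^+ (q ^ k).
Proof.
rewrite /alg_trace -trace_map_mx; set M := passmx.mxof _ _ _.
pose D := diag_mx (\row_(k < n) sigma a ^+ (q ^ k)).
have eMV : map_mx iota M *m V = V *m D.
  apply/matrixP => j k; rewrite mul_mx_diag !mxE.
  rewrite -exprMn -rmorphM.
  have -> : e`_j * a = passmx.vecof e (row j M).
    have -> : e`_j * a = amulr a e`_j by rewrite lfunE.
    by rewrite -{1}(passmx.vecof_delta e j) (passmx.hom_vecof e e_basis) -rowE.
  rewrite sigma_vecof frob_card_sum; apply: eq_bigr => i _.
  by rewrite !mxE exprMn frob_iota.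
have -> : map_mx iota M = V *m D *m invmx V by rewrite -eMV mulmxK.
rewrite mxtrace_mulC mulmxA mulVmx // mul1mx mxtrace_diag.
by apply: eq_bigr => k _; rewrite mxE.
Qed.

End Trace.

Lemma card_vect (F : finFieldType) (A : vectType F) (B : finType) (f : A -> B) :
  bijective f -> #|B| = (#|F| ^ \dim {:A})%N.
Proof.
case=> g fK gK; rewrite -(mul1n (\dim _)) -card_mx.
have eb : basis_of {:A} (vbasis {:A}) := vbasisP _.
apply: (bij_eq_card (f := fun b => passmx.rVof (vbasis {:A}) (g b))).
exists (fun u => f (passmx.vecof (vbasis {:A}) u)) => x.
  by rewrite (passmx.rVofK eb) gK.
by rewrite fK (passmx.vecofK eb).
Qed.

Lemma sum_ord_mul (V : nmodType) d r (E : nat -> V) :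
  \sum_(i < d * r) E i = \sum_(j < d) \sum_(k < r) E (r * j + k)%N.
Proof.
elim: d => [|d IH]; first by rewrite mul0n !big_ord0.
by rewrite big_ord_recr /= -IH mulSnr big_split_ord /= mulnC.
Qed.

Section Hasse.
Variables (F : finFieldType) (p : nat) (hp : p \in [pchar F]).
Variables (K : fieldType) (iota : {rmorphism F -> K}).
Variables (P : {poly F}) (mi : monic_irreducible_poly P) (x : K).
Hypothesis Px : root (map_poly iota P) x.

Local Notation q := #|F|.
Local Notation L := {poly %/ P with mi}.

Definition qeval (a : L) : K := (map_poly iota (val a)).[x].

Lemma qeval_in_qpoly f : qeval (in_qpoly P f : L) = (map_poly iota f).[x].
Proof.
rewrite /qeval /= (mk_monicE mi) [in RHS](Pdiv.RingMonic.rdivp_eq mi.2 f).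
by rewrite rmorphD rmorphM /= hornerD hornerM (rootP Px) mulr0 add0r.
Qed.

Lemma qeval_zmod : zmod_morphism qeval.
Proof. by move=> a b; rewrite /qeval /= rmorphB hornerD hornerN. Qed.

Lemma qeval_monoid : monoid_morphism qeval.
Proof.
split; first by rewrite /qeval /= rmorph1 hornerC.
move=> a b; have -> : a * b = (in_qpoly P (val a * val b) : L).
  by apply/val_inj.
by rewrite qeval_in_qpoly rmorphM hornerM.
Qed.

HB.instance Definition _ := GRing.isZmodMorphism.Build L K qeval qeval_zmod.
HB.instance Definition _ := GRing.isMonoidMorphism.Build L K qeval qeval_monoid.

Lemma qeval_alg c : qeval (c%:A) = iota c.
Proof.
rewrite /qeval; have -> : val (c%:A : L) = c%:P by rewrite /= -mul_polyC mulr1.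
by rewrite map_polyC hornerC.
Qed.

Lemma qeval_residue D :
  qeval (residue mi D) = (map_poly iota (rnum D)).[x] / (map_poly iota (rden D)).[x].
Proof. by rewrite /residue fmorph_div /= !qeval_in_qpoly. Qed.

Lemma dim_qfpoly : \dim {:L} = (size P).-1.
Proof.
apply/eqP; rewrite -(eqn_exp2l (m := q)) ?finNzRing_gt1 //; apply/eqP.
by rewrite -(card_vect (f := @id L)) ?card_qfpoly //; exists id.
Qed.

Lemma dim_pPrimeCharType : \dim {:pPrimeCharType hp} = logn p q.
Proof.
have pp := pcharf_prime hp.
apply/eqP; rewrite -(eqn_exp2l (m := p)) ?prime_gt1 //; apply/eqP.
have := card_vect (f := @id (pPrimeCharType hp)); rewrite card_Fp // => <-.
  exact: card_finField_pchar hp.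
by exists id.
Qed.

Lemma hasse_frob (D : ratfun F) :
  (hasse_symbol hp mi D == 0) =
  (frob_trace p (logn p q * (size P).-1) (qeval (residue mi D)) == 0).
Proof.
have hpK : p \in [pchar K] by rewrite (rmorph_pchar iota).
pose iotap : {rmorphism 'F_p -> pPrimeCharType hpK} := in_alg (pPrimeCharType hpK).
rewrite -(fmorph_eq0 iotap) /hasse_symbol.
rewrite (alg_trace_frob (A := pPrimeCharType hp) (iota := iotap)
   (sigma := iota : {rmorphism pPrimeCharType hp -> pPrimeCharType hpK})).
- rewrite /frob_trace dim_pPrimeCharType [in RHS]mulnC.
  rewrite (sum_ord_mul _ _ (fun i => qeval (residue mi D) ^+ (p ^ i))) exchange_big /=.
  congr (_ == 0); apply: eq_bigr => k _.
  rewrite (alg_trace_frob (sigma := qeval)); last exact: fmorph_inj.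
    rewrite card_Fp ?(pcharf_prime hp) // dim_qfpoly pchar_expr_sum //.
    apply: eq_bigr => j _; rewrite -exprM {1}(card_finField_pchar hp) -expnM -expnD.
    by [].
  exact: qeval_alg.
- move=> c; have -> : c%:A = (c : nat)%:R * 1 :> pPrimeCharType hp by [].
  by rewrite rmorphM rmorph_nat rmorph1.
- exact: fmorph_inj.
Qed.
End Hasse.

(** * Primes and rational points *)

Lemma size_Xn_sub_X (K : nzRingType) n : (1 < n)%N -> size ('X^n - 'X : {poly K}) = n.+1.
Proof. by move=> n1; rewrite size_polyDl ?size_polyXn // size_polyN size_polyX. Qed.

Section FrobeniusPoints.
Variables (F : finFieldType) (K : closedFieldType) (iota : {rmorphism F -> K}).
Local Notation q := #|F|.

Let q1 : (1 < q)%N := finNzRing_gt1 F.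

Definition frob_points (N : nat) : seq K :=
  sval (closed_field_poly_normal ('X^(q ^ N) - 'X : {poly K})).

Lemma frob_points_prod N : (0 < N)%N ->
  'X^(q ^ N) - 'X = \prod_(z <- frob_points N) ('X - z%:P).
Proof.
move=> N0; have qN : (1 < q ^ N)%N by rewrite -(expn0 q) ltn_exp2l.
rewrite /frob_points; case: closed_field_poly_normal => s /= {1}->.
rewrite lead_coefDl ?lead_coefXn ?scale1r //.
by rewrite size_polyN size_polyX size_polyXn.
Qed.

Lemma mem_frob_points N x : (0 < N)%N -> (x \in frob_points N) = (x ^+ (q ^ N) == x).
Proof.
move=> N0; rewrite -root_prod_XsubC -frob_points_prod //.
by rewrite /root !hornerE subr_eq0.
Qed.

Lemma size_frob_points N : (0 < N)%N -> size (frob_points N) = (q ^ N)%N.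
Proof.
move=> N0; apply: succn_inj.
rewrite -(size_prod_XsubC (frob_points N) id) -frob_points_prod //.
by rewrite size_Xn_sub_X // -(expn0 q) ltn_exp2l.
Qed.

Lemma separable_Xq_sub_X N : (0 < N)%N -> separable_poly ('X^(q ^ N) - 'X : {poly K}).
Proof.
move=> N0; have [p pp hp] := finPcharP F.
have e0 : (q ^ N)%:R = 0 :> {poly K}.
  rewrite natrX (card_finField_pchar hp) natrX.
  have -> : p%:R = 0 :> {poly K}.
    by rewrite -[LHS](rmorph_nat (@polyC K)) -(rmorph_nat iota) (pcharf0 hp) !rmorph0.
  have r0 : (0 < logn p q)%N.
    by rewrite -(ltn_exp2l _ _ (prime_gt1 pp)) expn0 -(card_finField_pchar hp).
  by rewrite -exprM expr0n muln_eq0 !gtn_eqF.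
rewrite separable_poly.unlock derivB derivXn derivX -mulr_natr e0 mulr0 sub0r.
by rewrite -[X in coprimep _ X]scaleN1r coprimepZr ?coprimep1 // oppr_eq0 oner_eq0.
Qed.

Lemma uniq_frob_points N : (0 < N)%N -> uniq (frob_points N).
Proof.
by move=> N0; rewrite -separable_prod_XsubC -frob_points_prod // separable_Xq_sub_X.
Qed.

Lemma frob_horner (f : {poly F}) x N :
  (map_poly iota f).[x ^+ (q ^ N)] = (map_poly iota f).[x] ^+ (q ^ N).
Proof.
rewrite !horner_coef size_map_poly (frob_card_sum iota).
apply: eq_bigr => i _; rewrite coef_map exprMn (frob_iota iota).
by rewrite -!exprM mulnC.
Qed.

Lemma irreducible_root_dvdp (P f : {poly F}) x : irreducible_poly P ->
  root (map_poly iota P) x -> root (map_poly iota f) x -> P %| f.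
Proof.
move=> iP Px fx; apply/negPn; rewrite -(irreducible_poly_coprime _ iP).
apply/negP; rewrite -(coprimep_map iota) => cp.
by have := coprimep_root cp Px; rewrite -rootE fx.
Qed.

Lemma irreducible_eq (P Q : {poly F}) x : irreducible_poly P -> irreducible_poly Q ->
  P \is monic -> Q \is monic ->
  root (map_poly iota P) x -> root (map_poly iota Q) x -> P = Q.
Proof.
move=> iP iQ mP mQ Px Qx; apply/eqP; rewrite -eqp_monic // /eqp.
by rewrite (irreducible_root_dvdp iP Px Qx) (irreducible_root_dvdp iQ Qx Px).
Qed.

Lemma exists_min_poly (h : {poly F}) x : h != 0 -> root (map_poly iota h) x ->
  exists P : {poly F}, [/\ irreducible_poly P, P \is monic & root (map_poly iota P) x].
Proof.
move: {2}(size h) (leqnn (size h)) => n; elim: n h => [|n IH] h.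
  by rewrite leqn0 size_poly_eq0 => ->.
move=> hn h0 hx.
have h1 : (1 < size h)%N.
  rewrite ltnNge; apply/negP => /size1_polyC eh; move: hx h0; rewrite eh map_polyC /=.
  by rewrite rootC fmorph_eq0 polyC_eq0 => ->.
have [P [iP mP /dvdpP[h' eh]]] := monic_irreducible_factor h1.
move: hx; rewrite eh rmorphM rootM => /orP[h'x|Px]; last by exists P.
have h'0 : h' != 0 by apply: contraNneq h0 => e; rewrite eh e mul0r.
apply: (IH h') => //; rewrite -ltnS; apply: leq_trans hn.
rewrite eh size_mul //; last exact: irredp_neq0.
by apply: ltn_pred_add iP.1; rewrite size_poly_gt0.
Qed.

Lemma dvdp_Xq_sub_X (P : {poly F}) : irreducible_poly P -> P \is monic ->
  P %| 'X^(q ^ (size P).-1) - 'X.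
Proof.
move=> iP mP; pose mi : monic_irreducible_poly P := (iP, mP).
rewrite -(in_qpoly_eq0 _ mi) rmorphB rmorphXn /= subr_eq0 -(card_qfpoly mi).
by apply/eqP; apply: (@expf_card {poly %/ P with mi}).
Qed.

Lemma root_frob_points (P : {poly F}) x : irreducible_poly P -> P \is monic ->
  root (map_poly iota P) x -> x ^+ (q ^ (size P).-1) = x.
Proof.
move=> iP mP Px; have := dvdp_Xq_sub_X iP mP.
rewrite -(dvdp_map iota) rmorphB rmorphXn /= map_polyX => /dvdpP[f ef].
apply/eqP; rewrite -subr_eq0; have := congr1 (fun g : {poly K} => g.[x]) ef.
by rewrite /= !hornerE (rootP Px) mulr0 => ->.
Qed.

Lemma degree_le_frob (P : {poly F}) x N : irreducible_poly P -> P \is monic ->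
  root (map_poly iota P) x -> (0 < N)%N -> x ^+ (q ^ N) = x -> ((size P).-1 <= N)%N.
Proof.
move=> iP mP Px N0 xN; pose mi : monic_irreducible_poly P := (iP, mP).
pose L := {poly %/ P with mi}.
rewrite -(leq_exp2l (m := q)) // -(card_qfpoly mi) -(size_frob_points N0).
rewrite cardE -(size_map (fun a : L => qeval iota x a)).
apply: uniq_leq_size.
  rewrite map_inj_uniq ?enum_uniq // => a b eab.
  apply/eqP; rewrite -subr_eq0.
  have -> : a - b = in_qpoly P (val a - val b).
    rewrite rmorphB; congr (_ - _); apply/val_inj; symmetry;
    by apply: in_qpoly_small; apply: size_mk_monic.
  rewrite (in_qpoly_eq0 _ mi); apply: (irreducible_root_dvdp iP Px).
  by rewrite rootE rmorphB hornerD hornerN subr_eq0; apply/eqP.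
by move=> _ /mapP[a _ ->]; rewrite mem_frob_points // /qeval -frob_horner xN.
Qed.

Lemma frob_gcd (x : K) a b : (0 < a)%N -> x ^+ (q ^ a) = x -> x ^+ (q ^ b) = x ->
  x ^+ (q ^ gcdn a b) = x.
Proof.
have iterq c k : x ^+ (q ^ c) = x -> x ^+ (q ^ (k * c)) = x.
  move=> xc; elim: k => [|k IH]; first by rewrite mul0n expn0 expr1.
  by rewrite mulSn expnD exprM xc IH.
move=> a0 xa xb; case: (egcdnP b a0) => km kn e _.
by have := iterq a km xa; rewrite e expnD exprM (iterq b kn xb).
Qed.

Lemma degree_dvd_frob (P : {poly F}) x N : irreducible_poly P -> P \is monic ->
  root (map_poly iota P) x -> (0 < N)%N -> x ^+ (q ^ N) = x -> ((size P).-1 %| N)%N.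
Proof.
move=> iP mP Px N0 xN; have xd := root_frob_points iP mP Px.
have d0 : (0 < (size P).-1)%N by rewrite -subn1 subn_gt0 iP.1.
have xg := frob_gcd d0 xd xN.
have g0 : (0 < gcdn (size P).-1 N)%N by rewrite gcdn_gt0 d0.
have le_dg := degree_le_frob iP mP Px g0 xg.
suff <- : gcdn (size P).-1 N = (size P).-1 by apply: dvdn_gcdr.
by apply/eqP; rewrite eqn_leq le_dg dvdn_leq // dvdn_gcdl.
Qed.

Lemma count_roots (P : {poly F}) : irreducible_poly P -> P \is monic ->
  count (root (map_poly iota P)) (frob_points (size P).-1) = (size P).-1.
Proof.
move=> iP mP; set N := (size P).-1.
have N0 : (0 < N)%N by rewrite /N -subn1 subn_gt0 iP.1.
have [s es] := closed_field_poly_normal (map_poly iota P).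
move: es; rewrite lead_coef_map (monicP mP) rmorph1 scale1r => es.
have us : uniq s.
  rewrite -separable_prod_XsubC -es; apply: dvdp_separable (separable_Xq_sub_X N0).
  by have := dvdp_Xq_sub_X iP mP; rewrite -(dvdp_map iota) rmorphB rmorphXn /= map_polyX.
have sN : size s = N.
  by have := size_prod_XsubC s id; rewrite -es size_map_poly /N => ->.
rewrite -size_filter -[RHS]sN; apply: perm_size; apply: uniq_perm => //.
  by apply: filter_uniq; apply: uniq_frob_points.
move=> x; rewrite mem_filter mem_frob_points // es root_prod_XsubC.
apply: andb_idr => xs; apply/eqP; apply: root_frob_points => //.
by rewrite es root_prod_XsubC.
Qed.

End FrobeniusPoints.

(** * Equidistribution of traces *)

Section FrobTrace.
Variables (K : fieldType) (p : nat).
Hypothesis hp : p \in [pchar K].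

Lemma frob_traceD m (x y : K) :
  frob_trace p m (x + y) = frob_trace p m x + frob_trace p m y.
Proof.
by rewrite /frob_trace -big_split; apply: eq_bigr => i _; rewrite pchar_exprD.
Qed.

Lemma frob_trace0 m : frob_trace p m (0 : K) = 0.
Proof. by apply: (addrI (frob_trace p m 0)); rewrite -frob_traceD !addr0. Qed.

Lemma frob_traceB m (x y : K) :
  frob_trace p m (x - y) = frob_trace p m x - frob_trace p m y.
Proof. by apply: (addIr (frob_trace p m y)); rewrite -frob_traceD !subrK. Qed.

Lemma frob_trace_natr m (n : nat) (x : K) :
  frob_trace p m (n%:R * x) = n%:R * frob_trace p m x.
Proof.
elim: n => [|n IH]; first by rewrite !mul0r frob_trace0.
by rewrite -natr1 !mulrDl !mul1r frob_traceD IH.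
Qed.

Lemma frob_trace_sum m (I : Type) (r : seq I) (P : pred I) (E : I -> K) :
  frob_trace p m (\sum_(i <- r | P i) E i) = \sum_(i <- r | P i) frob_trace p m (E i).
Proof. exact: (big_morph _ (frob_traceD m) (frob_trace0 m)). Qed.

Lemma frob_trace_as m (y : K) : y ^+ (p ^ m) = y -> frob_trace p m (y ^+ p - y) = 0.
Proof. by move=> hy; rewrite /frob_trace artin_schreier_tele // hy subrr. Qed.

Lemma frob_trace_exp m (y : K) : y ^+ (p ^ m) = y ->
  frob_trace p m y ^+ p = frob_trace p m y.
Proof.
move=> hy; apply/eqP; rewrite -subr_eq0 -(frob_trace_as hy) frob_traceB.
rewrite /frob_trace subr_eq; apply/eqP; rewrite subrK.
rewrite -[X in _ ^+ X = _](expn1 p) pchar_expr_sum // expn1.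
by apply: eq_bigr => i _; rewrite exprAC.
Qed.

Lemma Fp_fixed (y : K) : y ^+ p = y -> exists c : 'F_p, y = (c : nat)%:R.
Proof.
move=> hy; have pp := pcharf_prime hp.
pose f : {poly K} := 'X^p - 'X.
have sf : size f = p.+1 by rewrite size_Xn_sub_X // prime_gt1.
pose s := [seq (nat_of_ord c)%:R : K | c <- enum 'F_p].
have ss : size s = p by rewrite size_map -cardE card_Fp.
have [//|nex] := EM (exists c : 'F_p, y = (c : nat)%:R); exfalso.
suff : f = 0 by move/(congr1 (fun g : {poly K} => size g)); rewrite sf size_poly0.
have Fc (c : 'F_p) : (c < p)%N.
  by have := ltn_ord c; rewrite [X in (_ < X)%N -> _](Fp_cast pp).
apply: (roots_geq_poly_eq0 (rs := y :: s)).
- rewrite /= {1}/root !hornerE hy subrr eqxx /=; apply/allP => _ /mapP[c _ ->].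
  by rewrite /root !hornerE -(pFrobenius_autE hp) pFrobenius_aut_nat subrr.
- rewrite /= map_inj_uniq ?enum_uniq ?andbT.
    by apply/mapP => -[c _ ey]; apply: nex; exists c.
  by move=> c d /(pchar_natr_inj hp (Fc c) (Fc d)) /val_inj.
- by rewrite /= ss sf.
Qed.
End FrobTrace.

Section Evaluation.
Variables (F : fieldType) (K : fieldType) (iota : {rmorphism F -> K}) (x : K).
Local Notation "f %:F" := (@FracField.tofrac _ f).

Definition evals_to (D : ratfun F) (y : K) : Prop := exists n d : {poly F},
  [/\ D = n%:F / d%:F, (map_poly iota d).[x] != 0 &
      y = (map_poly iota n).[x] / (map_poly iota d).[x]].

Let nz (d : {poly F}) : (map_poly iota d).[x] != 0 -> d%:F != 0.
Proof. by apply: contraNneq => /eqP; rewrite tofrac_eq0 => /eqP ->; rewrite rmorph0 horner0. Qed.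

Lemma evals_to_uniq D y y' : evals_to D y -> evals_to D y' -> y = y'.
Proof.
case=> n [d [eD dx ->]] [n' [d' [eD' d'x ->]]].
have : n * d' = n' * d.
  apply/eqP; rewrite -tofrac_eq !tofracM -eqr_div ?nz //.
  by rewrite -eD -eD'.
move/(congr1 (fun f => (map_poly iota f).[x])); rewrite /= !rmorphM !hornerM => e.
by apply/eqP; rewrite eqr_div // e.
Qed.

Lemma evals_to_tofrac n : evals_to n%:F (map_poly iota n).[x].
Proof.
exists n, 1; rewrite tofrac1 rmorph1 hornerC !divr1 oner_eq0; split=> //.
Qed.

Lemma evals_toD D D' y y' : evals_to D y -> evals_to D' y' -> evals_to (D + D') (y + y').
Proof.
case=> n [d [-> dx ->]] [n' [d' [-> d'x ->]]]; exists (n * d' + n' * d), (d * d').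
rewrite !(rmorphD, rmorphM) hornerD !hornerM mulf_neq0 //; split=> //.
  by rewrite addf_div ?nz.
by rewrite addf_div.
Qed.

Lemma evals_toM D D' y y' : evals_to D y -> evals_to D' y' -> evals_to (D * D') (y * y').
Proof.
case=> n [d [-> dx ->]] [n' [d' [-> d'x ->]]]; exists (n * n'), (d * d').
by rewrite !rmorphM !hornerM mulf_neq0 // !mulf_div.
Qed.

Lemma evals_toN D y : evals_to D y -> evals_to (- D) (- y).
Proof.
case=> n [d [-> dx ->]]; exists (- n), d.
by rewrite !rmorphN hornerN !mulNr.
Qed.

Lemma evals_toX D y k : evals_to D y -> evals_to (D ^+ k) (y ^+ k).
Proof.
move=> h; elim: k => [|k IH]; last by rewrite !exprS; apply: evals_toM.
by have := evals_to_tofrac 1; rewrite tofrac1 rmorph1 hornerC.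
Qed.

Lemma evals_to_sum (I : Type) (r : seq I) (E : I -> ratfun F) (V : I -> K) :
  (forall i, evals_to (E i) (V i)) ->
  evals_to (\sum_(i <- r) E i) (\sum_(i <- r) V i).
Proof.
move=> h; elim: r => [|i r IH]; last by rewrite !big_cons; apply: evals_toD.
by rewrite !big_nil; have := evals_to_tofrac 0; rewrite tofrac0 rmorph0 horner0.
Qed.

Lemma evals_to_natr k : evals_to k%:R k%:R.
Proof. by have := evals_to_tofrac (k%:R)%:P; rewrite map_polyC hornerC /= !rmorph_nat. Qed.
End Evaluation.

Section Equidistribution.
Variables (F : finFieldType) (p : nat) (hp : p \in [pchar F]).
Variables (K : closedFieldType) (iota : {rmorphism F -> K}).
Local Notation q := #|F|.
Local Notation "f %:F" := (@FracField.tofrac _ f).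
Local Notation "f ^i" := (map_poly iota f) (at level 2, format "f ^i").

Let hpK : p \in [pchar K]. Proof. by rewrite (rmorph_pchar iota). Qed.
Let pp : prime p := pcharf_prime hp.
Let p0 : (0 < p)%N := prime_gt0 pp.

Lemma good_pole_bound (g h : {poly F}) : h != 0 -> good_pole p g h ->
  trace_count_bound p g^i h^i.
Proof.
move=> h0 [[hgh pd]|[P [e [h1 [[iP mP] eh nP1 nPg /andP[e0 pe]]]]]].
  by apply: trace_count_infinity; rewrite ?map_poly_eq0 ?size_map_poly.
have /closed_rootP[rho Prho] : size P^i != 1%N by rewrite size_map_poly gtn_eqF ?iP.1.
have sepP : separable_poly P^i.
  have N0 : (0 < (size P).-1)%N by rewrite -subn1 subn_gt0 iP.1.
  apply: dvdp_separable (separable_Xq_sub_X iota N0).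
  by have := dvdp_Xq_sub_X iP mP; rewrite -(dvdp_map iota) rmorphB rmorphXn /= map_polyX.
have /factor_theorem[P1 eP] := Prho.
have P1r : P1.[rho] != 0 by move: sepP; rewrite eP separable_root => /andP[].
have nroot (f : {poly F}) : ~~ (P %| f) -> (f^i).[rho] != 0.
  by apply: contra => fr; apply: (irreducible_root_dvdp iP Prho).
apply: (@trace_count_pole _ p _ _ (P1 ^+ e * h1^i) rho e) => //; last exact: nroot.
  by rewrite eh rmorphM rmorphXn /= eP exprMn mulrAC mulrC mulrA.
by rewrite hornerM horner_exp mulf_neq0 ?expf_neq0 ?nroot.
Qed.

Local Notation r := (logn p q).
Local Notation tr N := (frob_trace p (r * N)).

Lemma expp_rN N : (p ^ (r * N) = q ^ N)%N.
Proof. by rewrite expnM -(card_finField_pchar hp). Qed.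

Lemma as_equiv_trace f f' G x y y' t N : f - f' = G ^+ p - G ->
  evals_to iota x f y -> evals_to iota x f' y' -> evals_to iota x G t ->
  x ^+ (q ^ N) = x -> tr N y = tr N y'.
Proof.
move=> eG fy fy' Gt xN.
have e1 : y - y' = t ^+ p - t.
  apply: (@evals_to_uniq _ _ iota x (f - f')).
    by apply: evals_toD => //; apply: evals_toN.
  rewrite eG; apply: evals_toD; last exact: evals_toN.
  exact: evals_toX.
have tN : t ^+ (p ^ (r * N)) = t.
  case: Gt => n [d [_ _ ->]]; rewrite expp_rN exprMn exprVn.
  by rewrite -!frob_horner xN.
by apply/eqP; rewrite -subr_eq0 -frob_traceB // e1 frob_trace_as.
Qed.

(* p ^ half_exp N is q^(N/2) up to a factor p. *)
Definition half_exp N : nat := (r * N - (r * N)./2)%N.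

Lemma count_root_le (w : {poly K}) (s : seq K) : w != 0 -> uniq s ->
  (count (root w) s <= size w)%N.
Proof.
move=> w0 us; rewrite -size_filter; apply: ltnW; apply: max_poly_roots => //.
  by apply/allP => x; rewrite mem_filter => /andP[].
exact: filter_uniq.
Qed.

Lemma equidistribution (f : ratfun F) (val : K -> K) (ok : pred K) :
  (forall x, ok x -> evals_to iota x f (val x)) ->
  ~ (exists c : F, as_equiv p f (c%:P)%:F) ->
  exists C N0 : nat, forall N (c : K), (N0 <= N)%N ->
  (p * count (fun x => ok x && (tr N (val x) == c)) (frob_points F K N)
     <= q ^ N + C * p ^ half_exp N)%N.
Proof.
move=> hval nc.
have [[c]|[g [h [h0 gp [G eG]]]]] := reduce_poles hp (rnum f) (rden_neq0 f).
  by rewrite -rnum_rdenE => hc; case: nc; exists c.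
rewrite -rnum_rdenE in eG.
have [C [N0 H]] := good_pole_bound h0 gp.
pose w := h^i * (rden G)^i.
have w0 : w != 0 by rewrite mulf_neq0 ?map_poly_eq0 ?rden_neq0.
exists (C + p * size w)%N, (N0.*2.+1) => N c hN.
have N_gt0 : (0 < N)%N by apply: leq_trans hN.
pose S := fun x => ok x && (tr N (val x) == c).
pose Z := [seq x <- frob_points F K N | S x && ~~ root w x].
have r0 : (0 < r)%N.
  by rewrite -(ltn_exp2l _ _ (prime_gt1 pp)) expn0 -(card_finField_pchar hp) finNzRing_gt1.
have uE := uniq_frob_points iota N_gt0.
have cS : (count S (frob_points F K N) <= size Z + size w)%N.
  rewrite size_filter; apply: leq_trans (leq_add (leqnn _) (count_root_le w0 uE)).
  rewrite -count_predUI; apply: leq_trans (leq_addr _ _).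
  apply: sub_count => x /= Sx; rewrite Sx /=.
  by case: (root w x).
have sZ : (p * size Z <= q ^ N + C * p ^ half_exp N)%N.
  have half_sum : ((r * N)./2 + half_exp N = r * N)%N.
    by rewrite subnKC // leq_half_double; lia.
  have wf x : x \in Z -> [/\ x ^+ (q ^ N) = x, h^i.[x] != 0 & tr N (g^i.[x] / h^i.[x]) = c].
    rewrite mem_filter /w => /andP[/andP[/andP[okx /eqP <-]]].
    rewrite rootM negb_or => /andP[hx Gx].
    rewrite mem_frob_points // => /eqP xN; split=> //.
    apply/esym; apply: (as_equiv_trace (f' := g%:F / h%:F) eG (hval x okx)) => //.
      by exists g, h.
    by exists (rnum G), (rden G); split=> //; apply: rnum_rdenE.
  case: (posnP (size Z)) => [->|Z0]; first by rewrite muln0.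
  have [x1 x1Z] : exists x1, x1 \in Z by exists (nth 0 Z 0); apply: mem_nth.
  have [_ _ tr1] := wf _ x1Z.
  rewrite -expp_rN -half_sum; apply: (H (g^i.[x1] / h^i.[x1])).
  - rewrite /half_exp; have : (N <= r * N)%N by rewrite leq_pmull.
    by move: hN; move: (r * N)%N; lia.
  - exact: filter_uniq.
  move=> x xZ; have [xN hx trx] := wf x xZ.
  rewrite half_sum expp_rN -!frob_horner !xN; split=> //.
  by rewrite frob_traceB // trx tr1 subrr.
rewrite -/S; apply: (@leq_trans (p * (size Z + size w))%N).
  by rewrite leq_mul2l cS orbT.
rewrite mulnDr mulnDl addnA leq_add // leq_pmulr // expn_gt0 p0.
by [].
Qed.
End Equidistribution.

Lemma card_linear_fiber (R : finFieldType) (l : nat) (c : 'I_l -> R) :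
  (#|R| * #|[pred a : {ffun 'I_l -> R} | (\sum_i a i * c i == 0)%R]| =
   #|R| ^ l * (if [forall i, c i == 0%R] then #|R| else 1))%N.
Proof.
case: ifPn => [/forallP c0|/forallPn[i0 ci0]].
  rewrite mulnC; congr (_ * _)%N; rewrite -[l in RHS]card_ord -card_ffun.
  apply: eq_card => a; rewrite !inE big1 ?eqxx // => i _.
  by rewrite (eqP (c0 i)) mulr0.
pose phi (a : {ffun 'I_l -> R}) := \sum_i a i * c i.
have fiber t : #|[pred a | phi a == t]| = #|[pred a | phi a == 0]|.
  pose s : {ffun 'I_l -> R} := [ffun i => if i == i0 then t / c i0 else 0].
  have phis a : phi (a + s) = phi a + t.
    have <- : \sum_i s i * c i = t.
      rewrite (bigD1 i0) //= big1 => [|i ni]; first by rewrite ffunE eqxx divfK ?addr0.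
      by rewrite ffunE (negPf ni) mul0r.
    by rewrite -big_split; apply: eq_bigr => i _; rewrite ffunE mulrDl.
  rewrite -!sum1_card (reindex_inj (addIr s)) /=; apply: eq_bigl => a.
  by rewrite !inE phis -{2}[t]add0r (inj_eq (addIr t)).
rewrite muln1 -[l in RHS]card_ord -card_ffun -[in RHS]sum1_card.
rewrite (partition_big phi xpredT) //= -sum1_card big_distrl /=.
apply: eq_big => // t _; rewrite mul1n -(fiber t) -sum1_card.
by apply: eq_bigl => a; rewrite inE.
Qed.

Section Counting.
Variables (F : finFieldType) (p : nat) (hp : p \in [pchar F]).
Variables (K : closedFieldType) (iota : {rmorphism F -> K}).
Variables (l : nat) (D : 'I_l -> ratfun F).
Local Notation q := #|F|.
Local Notation "f %:F" := (@FracField.tofrac _ f).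
Local Notation "f ^i" := (map_poly iota f) (at level 2, format "f ^i").
Local Notation E N := (frob_points F K N).
Local Notation r := (logn p q).
Local Notation tr N := (frob_trace p (r * N)).

Let hpK : p \in [pchar K]. Proof. by rewrite (rmorph_pchar iota). Qed.
Let pp : prime p := pcharf_prime hp.
Let p0 : (0 < p)%N := prime_gt0 pp.

Definition regular (x : K) : bool := [forall i, (rden (D i))^i.[x] != 0].
Definition value (i : 'I_l) (x : K) : K := (rnum (D i))^i.[x] / (rden (D i))^i.[x].
Definition comb (a : {ffun 'I_l -> 'F_p}) : ratfun F := \sum_(i < l) (a i : nat)%:R * D i.
Definition comb_value (a : {ffun 'I_l -> 'F_p}) (x : K) : K :=
  \sum_(i < l) (a i : nat)%:R * value i x.

Lemma evals_to_comb a x : regular x -> evals_to iota x (comb a) (comb_value a x).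
Proof.
move/forallP => rx; apply: evals_to_sum => i; apply: evals_toM.
  exact: evals_to_natr.
by exists (rnum (D i)), (rden (D i)); split=> //; apply: rnum_rdenE.
Qed.

Lemma tr_comb_value a x N : tr N (comb_value a x) = \sum_i (a i : nat)%:R * tr N (value i x).
Proof.
by rewrite frob_trace_sum //; apply: eq_bigr => i _; rewrite frob_trace_natr.
Qed.

Lemma tr_value_Fp i x N : x ^+ (q ^ N) = x ->
  exists c : 'F_p, tr N (value i x) = (c : nat)%:R.
Proof.
move=> xN; apply: (Fp_fixed hpK); apply: (frob_trace_exp hpK).
by rewrite (expp_rN hp) /value exprMn exprVn -!frob_horner xN.
Qed.

Definition zero_points N : pred K :=
  fun x => regular x && [forall i, tr N (value i x) == 0].

Let psi : {rmorphism 'F_p -> pPrimeCharType hpK} := in_alg (pPrimeCharType hpK).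

Let psiE c : psi c = (c : nat)%:R :> K.
Proof. by rewrite -[RHS]mulr1. Qed.

Lemma card_comb_zero x N : x ^+ (q ^ N) = x ->
  (p * #|[pred a | (tr N (comb_value a x) == 0)%R]| =
   p ^ l * (if [forall i, tr N (value i x) == 0%R] then p else 1))%N.
Proof.
move=> xN.
have /fin_all_exists[c hc] := fun i => tr_value_Fp i xN.
have := card_linear_fiber c; rewrite card_Fp // => H.
have -> : [forall i, tr N (value i x) == 0] = [forall i, c i == 0].
  apply: eq_forallb => i; rewrite hc -psiE.
  by rewrite -[RHS](fmorph_eq0 psi).
rewrite -H; congr (_ * _)%N; apply: eq_card => a; rewrite !inE tr_comb_value.
rewrite -[RHS](fmorph_eq0 psi) rmorph_sum; congr (_ == 0).
apply: eq_bigr => i _; rewrite hc -(psiE (a i)) -(psiE (c i)).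
exact: esym (rmorphM psi _ _).
Qed.

Definition comb_count N (a : {ffun 'I_l -> 'F_p}) : nat :=
  count (fun x => regular x && (tr N (comb_value a x) == 0)) (E N).

(* Stated additively to avoid truncated subtractions. *)
Lemma sum_comb_count N : (0 < N)%N ->
  (p * \sum_a comb_count N a + p ^ l * count (zero_points N) (E N) =
   p ^ l * count regular (E N) + p ^ l * (p * count (zero_points N) (E N)))%N.
Proof.
move=> N0.
have cE (P : pred K) : count P (E N) = (\sum_(x <- E N) P x)%N.
  by rewrite -sum1_count [RHS]big_mkcond /= big_mkcond; apply: eq_bigr => x _; case: (P x).
rewrite /comb_count !cE; under eq_bigr do rewrite cE.
rewrite exchange_big /= !big_distrr /= -!big_split /= big_seq [RHS]big_seq.
apply: eq_bigr => x; rewrite mem_frob_points // => /eqP xN.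
rewrite /zero_points; case: (regular x) => /=; last by rewrite big1 // !muln0.
have := card_comb_zero xN; rewrite -sum1_card big_mkcond /=.
under eq_bigr do rewrite inE.
by move=> ->; case: [forall i, _]; rewrite /= ?muln1 ?muln0 ?addn0 // addnC.
Qed.

Lemma count_regular_ge : exists C : nat, forall N, (0 < N)%N ->
  (q ^ N <= count regular (E N) + C)%N.
Proof.
pose w := \prod_i (rden (D i))^i.
have w0 : w != 0 by apply/prodf_neq0 => i _; rewrite map_poly_eq0 rden_neq0.
exists (size w) => N N0.
rewrite -(size_frob_points F K N0) -(count_predC regular) leq_add2l.
apply: leq_trans (count_root_le w0 (uniq_frob_points iota N0)).
apply: sub_count => x /= /forallPn[i]; rewrite negbK => ri.
by rewrite /root /w (bigD1 i) //= hornerM (eqP ri) mul0r.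
Qed.

Lemma comb_count_trivial a : as_equiv p (comb a) 0 ->
  exists C : nat, forall N, (0 < N)%N -> (count regular (E N) <= comb_count N a + C)%N.
Proof.
case=> G eG; exists (size (rden G)^i) => N N0.
have d0 : (rden G)^i != 0 by rewrite map_poly_eq0 rden_neq0.
apply: leq_trans (leq_add (leqnn _) (count_root_le d0 (uniq_frob_points iota N0))).
rewrite /comb_count -count_predUI; apply: leq_trans (leq_addr _ _).
rewrite -!size_filter; apply: uniq_leq_size; first exact/filter_uniq/uniq_frob_points.
move=> x; rewrite !mem_filter => /andP[rx xE]; rewrite xE /= rx andbT /=.
have [//|Gx] := boolP (root (rden G)^i x); first by rewrite orbT.
rewrite orbF; apply/eqP; rewrite -(frob_trace0 hpK (r * N)).
apply: (as_equiv_trace hp eG (evals_to_comb a rx)).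
- by have := evals_to_tofrac iota x 0; rewrite tofrac0 rmorph0 horner0.
- by exists (rnum G), (rden G); split=> //; apply: rnum_rdenE.
- by apply/eqP; rewrite -mem_frob_points.
Qed.

Lemma comb_count_nontrivial a :
  ~ (exists c : F, as_equiv p (comb a) (c%:P)%:F) ->
  exists C N0 : nat, forall N, (N0 <= N)%N ->
  (p * comb_count N a <= q ^ N + C * p ^ half_exp F p N)%N /\
  (q ^ N <= p * comb_count N a + C * p ^ half_exp F p N)%N.
Proof.
move=> nc; have [C [N0 H]] := equidistribution hp (evals_to_comb a) nc.
have [C0 H0] := count_regular_ge.
exists (p * C + p * C0)%N, (maxn N0 1) => N; rewrite geq_max => /andP[hN N1].
have h0 := H N 0 hN.
set e := (p ^ half_exp F p N)%N in h0 *.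
have e0 : (0 < e)%N by rewrite expn_gt0 p0.
split.
  apply: leq_trans h0 _; rewrite leq_add2l leq_mul2r; apply/orP; right.
  by apply: leq_trans (leq_addr _ _); apply: leq_pmull.
pose Z (c : 'F_p) := count (fun x => regular x && (tr N (comb_value a x) == (c : nat)%:R)) (E N).
have sumZ : (count regular (E N) <= \sum_c Z c)%N.
  have cE (P : pred K) : count P (E N) = (\sum_(x <- E N) P x)%N.
    by rewrite -sum1_count [RHS]big_mkcond /= big_mkcond; apply: eq_bigr => x _; case: (P x).
  rewrite /Z cE [X in (_ <= X)%N](eq_bigr _ (fun c _ => cE _)).
  rewrite exchange_big /= big_seq [X in (_ <= X)%N]big_seq.
  apply: leq_sum => x; rewrite mem_frob_points // => /eqP xN.
  case: (regular x) => //=.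
  have /(Fp_fixed hpK)[c hc] : tr N (comb_value a x) ^+ p = tr N (comb_value a x).
    apply: (frob_trace_exp hpK); rewrite (expp_rN hp) (frob_card_sum iota).
    apply: eq_bigr => i _; rewrite exprMn -(rmorph_nat iota) (frob_iota iota).
    by rewrite /value exprMn exprVn -!frob_horner xN.
  by rewrite (bigD1 c) //= hc eqxx.
have Z0 : Z 0 = comb_count N a by [].
have : (\sum_(c | c != 0%R) p * Z c <= (p - 1) * (q ^ N + C * e))%N.
  have -> : (p - 1)%N = #|[pred c : 'F_p | c != 0%R]|.
    by rewrite subn1 -[p in LHS](card_Fp pp) (cardD1 0) inE; apply: eq_card => c; rewrite !inE andbT.
  rewrite -sum_nat_const; apply: leq_sum => c _; exact: H.
rewrite -big_distrr /= => hsum; have hreg := H0 N N1.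
have : (p * q ^ N <= p * (\sum_c Z c + C0))%N.
  by rewrite leq_mul2l (leq_trans hreg) ?orbT // leq_add2r.
rewrite (bigD1 0) //= Z0; move: hsum e0.
set S := (\sum_(c | _) _)%N; move: (comb_count N a) S (q ^ N)%N => z S Q.
have := p0; move: (p) => p'; case: p' => // k _; rewrite subn1 /= => h1 h2 h3.
have h4 : (k.+1 * C0 <= k.+1 * C0 * e)%N by rewrite leq_pmulr.
by nia.
Qed.

Lemma count_degree_points (T : set {poly F}) (ok : pred K) N : (0 < N)%N ->
  (forall P, T P -> irreducible_poly P /\ P \is monic) ->
  (forall P x, irreducible_poly P -> P \is monic -> size P = N.+1 -> root P^i x ->
     (T P <-> ok x)) ->
  (count_degree T N * N <= count ok (E N))%N /\
  (count ok (E N) <= count_degree T N * N + \sum_(d < N./2.+1) q ^ d)%N.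
Proof.
move=> N0 Tirr Tok.
have cE (P : pred K) : count P (E N) = (\sum_(x <- E N) P x)%N.
  by rewrite -sum1_count [RHS]big_mkcond /= big_mkcond; apply: eq_bigr => x _; case: (P x).
pose A := [pred P : {poly_(N.+1) F} | (size (val P) == N.+1) && `[< T (val P) >]].
pose inner x := (\sum_(P in A) root (val P)^i x)%N.
have AE P : P \in A -> [/\ irreducible_poly (val P), val P \is monic, size (val P) = N.+1 & T (val P)].
  by rewrite inE => /andP[/eqP sP /asboolP TP]; have [] := Tirr _ TP.
have cdE : (count_degree T N * N = \sum_(x <- E N) inner x)%N.
  rewrite exchange_big /= /count_degree -sum_nat_const; apply: eq_bigr => P PA.
  have [iP mP sP _] := AE P PA.
  by rewrite -cE; have := count_roots iota iP mP; rewrite sP.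
pose low x := (\sum_(d < N./2.+1) ((0 < d) && (x \in E d)))%N.
split.
  rewrite cdE cE; apply: leq_sum => x _.
  have [/existsP[P /andP[PA Px]]|/existsPn nP] := boolP [exists P, (P \in A) && root (val P)^i x].
    have [iP mP sP TP] := AE P PA.
    rewrite /inner (bigD1 P) //= Px big1 => [|Q /andP[QA nQ]].
      by have /(Tok _ _ iP mP sP Px) -> := TP.
    have [iQ mQ sQ _] := AE Q QA; apply/eqP; rewrite eqb0; apply: contra nQ => Qx.
    by apply/eqP/val_inj; apply: (irreducible_eq iQ iP mQ mP Qx Px).
  rewrite /inner big1 // => P PA; have := nP P; rewrite PA /=.
  by case: (root _ _).
rewrite cdE cE; apply: (@leq_trans (\sum_(x <- E N) (inner x + low x))%N).
  rewrite big_seq [X in (_ <= X)%N]big_seq; apply: leq_sum => x xE.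
  case okx : (ok x) => //=.
  have xN : x ^+ (q ^ N) = x by apply/eqP; rewrite -mem_frob_points.
  have qN : (1 < q ^ N)%N by rewrite -(expn0 q) ltn_exp2l ?finNzRing_gt1.
  have h0 : 'X^(q ^ N) - 'X != 0 :> {poly F}.
    by rewrite -size_poly_eq0 size_Xn_sub_X.
  have hx : root ('X^(q ^ N) - 'X : {poly F})^i x.
    by rewrite rmorphB rmorphXn /= map_polyX /root !hornerE xN subrr.
  have [P [iP mP Px]] := exists_min_poly h0 hx.
  have sP0 : (0 < (size P).-1)%N by rewrite -subn1 subn_gt0 iP.1.
  have dN := degree_dvd_frob iP mP Px N0 xN.
  have [edN|ndN] := eqVneq (size P).-1 N.
    have sP : size P = N.+1 by rewrite -edN prednK // (ltn_trans _ iP.1).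
    have TP : T P by apply/(Tok P x iP mP sP Px).
    have sP' : (size P <= N.+1)%N by rewrite sP.
    pose P' : {poly_(N.+1) F} := NPoly (sP' : P \is a poly_of_size N.+1).
    have P'A : P' \in A by rewrite inE /= sP eqxx; apply/asboolP.
    by rewrite /inner (bigD1 P') //= Px.
  have dh : ((size P).-1 < N./2.+1)%N.
    case/dvdnP: dN => k ek; rewrite ltnS geq_half_double -muln2 mulnC ek.
    rewrite leq_mul2r; apply/orP; right.
    by case: k ek => [|[|k]] // ek; [rewrite ek in N0 | rewrite ek mul1n eqxx in ndN].
  have xl : x \in E (size P).-1.
    by rewrite mem_frob_points // (root_frob_points iP mP Px).
  by rewrite /low (bigD1 (Ordinal dh)) //= xl sP0 addnCA.
rewrite big_split /= leq_add2l exchange_big /=.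
apply: leq_sum => d _.
have [d0|d0] := posnP d; first by rewrite d0 expn0 -cE count_pred0.
rewrite -cE -(size_frob_points F K d0) -size_filter; apply: uniq_leq_size.
  exact/filter_uniq/uniq_frob_points.
by move=> x; rewrite mem_filter => /andP[].
Qed.
End Counting.

Lemma hasse_zero_setE (F : finFieldType) (p : nat) (hp : p \in [pchar F])
    (K : closedFieldType) (iota : {rmorphism F -> K})
    (l : nat) (D : 'I_l -> ratfun F) (P : {poly F}) (x : K) N :
  (forall i, D i != 0) -> irreducible_poly P -> P \is monic -> size P = N.+1 ->
  root (map_poly iota P) x -> hasse_zero_set hp D P <-> zero_points p iota D N x.
Proof.
move=> D0 iP mP sP Px.
have reg i : (~~ (P %| rden (D i))) = ((map_poly iota (rden (D i))).[x] != 0).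
  congr (~~ _); apply/idP/idP => [/dvdpP[f ->]|/(irreducible_root_dvdp iP Px) //].
  by rewrite rmorphM hornerM (rootP Px) mulr0.
have hasse (mi : monic_irreducible_poly P) i : (hasse_symbol hp mi (D i) == 0) =
    (frob_trace p (logn p #|F| * N) (value iota D i x) == 0).
  by rewrite (hasse_frob hp mi Px) qeval_residue // sP.
split.
  case=> mi h; apply/andP; split; apply/forallP => i; have [h1 h2] := h i.
    by rewrite -reg -ord_at_ge0.
  by rewrite -(hasse mi) h2.
case/andP => /forallP rx /forallP hx; exists (iP, mP) => i; split.
  by rewrite ord_at_ge0 // reg.
by apply/eqP; rewrite hasse.
Qed.

Lemma geometric_as_equiv (p : nat) (F : finFieldType) (hp : p \in [pchar F])
    (l : nat) (D : 'I_l -> ratfun F) (K : fieldExtType (ratfun F)) (alpha : 'I_l -> K)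
    (a : {ffun 'I_l -> 'F_p}) (c : F) :
  (forall i, alpha i ^+ p - alpha i = (D i)%:A) -> geometric_ext K ->
  as_equiv p (comb D a) (FracField.tofrac c%:P) -> as_equiv p (comb D a) 0.
Proof.
move=> halpha hgeo [G eG].
pose phi : {rmorphism ratfun F -> K} := in_alg K.
have hk : p \in [pchar (ratfun F)].
  by rewrite (rmorph_pchar (@FracField.tofrac {poly F})) // pchar_poly.
have hK : p \in [pchar K] by rewrite (rmorph_pchar phi).
pose y := \sum_i (a i : nat)%:R * alpha i - phi G.
have wp_natr (k : nat) (z : K) : (k%:R * z) ^+ p - k%:R * z = k%:R * (z ^+ p - z).
  by rewrite exprMn -(pFrobenius_autE hK k%:R) pFrobenius_aut_nat mulrBr.
have ey : y ^+ p - y = const_embed K c.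
  have -> : y ^+ p - y = \sum_i (a i : nat)%:R * (alpha i ^+ p - alpha i) - phi (G ^+ p - G).
    rewrite /y -[X in _ ^+ X](expn1 p) pchar_exprB // pchar_expr_sum // expn1.
    under [in RHS]eq_bigr do rewrite -wp_natr.
    rewrite sumrB rmorphB rmorphXn; ring.
  have -> : \sum_i (a i : nat)%:R * (alpha i ^+ p - alpha i) = phi (comb D a).
    by rewrite rmorph_sum; apply: eq_bigr => i _; rewrite halpha rmorphM rmorph_nat.
  by rewrite -eG rmorphB opprB addrC subrK.
have alg_y : algebraicOver (@const_embed F K) y.
  exists ('X^p - 'X - c%:P).
    rewrite -size_poly_eq0 -addrA -opprD size_polyDl ?size_polyXn // size_polyN.
    rewrite ltnS; apply: leq_trans (size_polyD _ _) _.
    rewrite geq_max size_polyX prime_gt1 ?(pcharf_prime hp) //=.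
    by apply: leq_trans (size_polyC_leq1 _) _; rewrite prime_gt0 ?(pcharf_prime hp).
  have -> : map_poly (@const_embed F K) ('X^p - 'X - c%:P) = 'X^p - 'X - (const_embed K c)%:P.
    have e : @const_embed F K =1 (phi \o (@FracField.tofrac {poly F}) \o polyC) by [].
    rewrite (eq_map_poly e) !rmorphB rmorphXn /= map_polyX map_polyC /=.
    by rewrite e.
  by rewrite /root !hornerE -ey subrr.
have [c' ec'] := hgeo y alg_y.
have ec : FracField.tofrac c%:P = (FracField.tofrac c'%:P) ^+ p - FracField.tofrac c'%:P.
  apply: (fmorph_inj phi).
  by rewrite -[LHS]/(const_embed K c) -ey ec' rmorphB rmorphXn.
exists (G + FracField.tofrac c'%:P).
rewrite subr0 -[comb D a](subrK (FracField.tofrac c%:P)) eG ec.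
by rewrite -[X in _ = _ ^+ X - _](expn1 p) pchar_exprD // expn1 opprD addrACA.
Qed.

(** * Density *)

Section Asymptotics.
Variable R : realType.
Implicit Types u e Q : nat -> nat.

Local Notation ratio u Q := (fun N => (u N)%:R / (Q N)%:R : R).

Lemma cvg_harmonic_bound e Q (C : nat) : (forall N, 0 < Q N)%N ->
  (forall N, e N * N.+1 <= C * Q N)%N -> (ratio e Q @ \oo --> (0 : R))%classic.
Proof.
move=> Q0 he.
apply: (@squeeze_cvgr _ _ _ _ (fun=> 0) (fun N => C%:R * @harmonic R N)).
- near=> N; rewrite divr_ge0 //= ler_pdivrMr ?ltr0n // mulrAC ler_pdivlMr ?ltr0n //.
  by rewrite -!natrM ler_nat.
- exact: cvg_cst.
- by rewrite -(mulr0 C%:R); apply: cvgM; [exact: cvg_cst|exact: cvg_harmonic].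
Unshelve. all: by end_near. Qed.

Lemma cvg_ratio u Q e (a b C N0 : nat) : (0 < a)%N -> (forall N, 0 < Q N)%N ->
  (ratio e Q @ \oo --> (0 : R))%classic ->
  (forall N, (N0 <= N)%N ->
     (a * u N <= b * Q N + C * e N)%N /\ (b * Q N <= a * u N + C * e N)%N) ->
  (ratio u Q @ \oo --> (b%:R / a%:R : R))%classic.
Proof.
move=> a0 Q0 e0 hu.
have aR : (0 : R) < a%:R by rewrite ltr0n.
apply: (@squeeze_cvgr _ _ _ _
  (fun N => b%:R / a%:R - C%:R / a%:R * ((e N)%:R / (Q N)%:R))
  (fun N => b%:R / a%:R + C%:R / a%:R * ((e N)%:R / (Q N)%:R))).
- near=> N; have [] := hu N; first by near: N; exact: nbhs_infty_ge.
  rewrite -!(ler_nat R) !natrD !natrM => h1 h2.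
  have QR : (0 : R) < (Q N)%:R by rewrite ltr0n.
  have eL : b%:R / a%:R - C%:R / a%:R * ((e N)%:R / (Q N)%:R) =
     (b%:R * (Q N)%:R - C%:R * (e N)%:R) / a%:R / (Q N)%:R :> R.
    by field; rewrite !gt_eqF.
  have eR : b%:R / a%:R + C%:R / a%:R * ((e N)%:R / (Q N)%:R) =
     (b%:R * (Q N)%:R + C%:R * (e N)%:R) / a%:R / (Q N)%:R :> R.
    by field; rewrite !gt_eqF.
  rewrite eL eR !ler_pM2r ?invr_gt0 // ler_pdivrMr // ler_pdivlMr //.
  by rewrite ![(u N)%:R * _]mulrC lerBlDr h2.
- rewrite -[X in (_ --> X)%classic]subr0 -(mulr0 (C%:R / a%:R)).
  by apply: cvgB; [exact: cvg_cst|apply: cvgM => //; exact: cvg_cst].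
- rewrite -[X in (_ --> X)%classic]addr0 -(mulr0 (C%:R / a%:R)).
  by apply: cvgD; [exact: cvg_cst|apply: cvgM => //; exact: cvg_cst].
Unshelve. all: by end_near. Qed.

Lemma cvg_fin_sum (I : finType) (f : I -> nat -> R) (L : I -> R) :
  (forall i, (f i @ \oo --> L i)%classic) ->
  ((fun N => \sum_i f i N) @ \oo --> \sum_i L i)%classic.
Proof.
move=> h; elim: (index_enum I) => [|i r IH].
  have -> : (fun N => \sum_(i <- [::]) f i N) = fun=> 0 by apply/funext => N; rewrite big_nil.
  by rewrite big_nil; exact: cvg_cst.
have -> : (fun N => \sum_(j <- i :: r) f j N) = (f i \+ fun N => \sum_(j <- r) f j N).
  by apply/funext => N; rewrite big_cons.
by rewrite big_cons; apply: cvgD.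
Qed.
Lemma cvg_affine (u v : nat -> R) (a b c d k : R) :
  (u @ \oo --> a)%classic -> (v @ \oo --> b)%classic ->
  ((fun N => (c * u N - d * v N) * k) @ \oo --> (c * a - d * b) * k)%classic.
Proof.
move=> ua vb; have cst (t : R) : ((fun _ : nat => t) @ \oo --> t)%classic by exact: cvg_cst.
by apply: cvgM; [apply: cvgB; apply: cvgM|].
Qed.
End Asymptotics.

Lemma sum_expn_le q n : (1 < q)%N -> (\sum_(d < n) q ^ d <= q ^ n)%N.
Proof.
move=> q1; elim: n => [|n IH]; first by rewrite big_ord0.
rewrite big_ord_recr /= expnS; apply: leq_trans (leq_add IH (leqnn _)) _.
by rewrite addnn -mul2n leq_mul2r q1 orbT.
Qed.

Lemma cvg_low_degree (R : realType) q : (1 < q)%N ->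
  ((fun N => (\sum_(d < N./2.+1) q ^ d)%N%:R / (q ^ N)%N%:R : R) @ \oo --> (0 : R))%classic.
Proof.
move=> q1; apply: (@cvg_harmonic_bound _ _ _ (q * 2)%N) => N.
  by rewrite expn_gt0 ltnW.
apply: (@leq_trans (q ^ N./2.+1 * (2 * q ^ (N - N./2)))%N).
  apply: leq_mul; first exact: sum_expn_le.
  apply: (@leq_trans (2 * (N - N./2).+1)%N); last by rewrite leq_mul2l ltn_expl.
  by rewrite -{1}[N]odd_double_half -{2}[N]odd_double_half; lia.
rewrite expnS mulnACA -expnD subnKC //.
by rewrite leq_half_double; lia.
Qed.

Lemma cvg_half_exp (R : realType) (F : finFieldType) p : p \in [pchar F] ->
  ((fun N => (p ^ half_exp F p N)%N%:R / (#|F| ^ N)%N%:R : R) @ \oo --> (0 : R))%classic.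
Proof.
move=> hp; have p1 := prime_gt1 (pcharf_prime hp).
apply: (@cvg_harmonic_bound _ _ _ 2) => N.
  by rewrite expn_gt0 ltnW ?finNzRing_gt1.
have r0 : (0 < logn p #|F|)%N.
  by rewrite -(ltn_exp2l _ _ p1) expn0 -(card_finField_pchar hp) finNzRing_gt1.
rewrite -(expp_rN hp) /half_exp; have : (N <= logn p #|F| * N)%N by rewrite leq_pmull.
move: (logn p #|F| * N)%N => m Nm.
have -> : (p ^ m = p ^ (m - m./2) * p ^ m./2)%N.
  by rewrite -expnD subnK // leq_half_double; lia.
rewrite mulnCA leq_mul2l; apply/orP; right.
apply: (@leq_trans (2 * (m./2).+1)%N); last by rewrite leq_mul2l ltn_expl.
by apply: leq_ltn_trans Nm _; rewrite -{1}[m]odd_double_half; lia.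
Qed.

Section Density.
Variables (R : realType) (F : finFieldType) (K : closedFieldType).
Variable iota : {rmorphism F -> K}.
Local Notation q := #|F|.

Lemma cvg_count_degree (T : set {poly F}) (ok : nat -> pred K) (L : R) :
  (forall P, T P -> irreducible_poly P /\ P \is monic) ->
  (forall N P x, irreducible_poly P -> P \is monic -> size P = N.+1 ->
     root (map_poly iota P) x -> (T P <-> ok N x)) ->
  ((fun N => (count (ok N) (frob_points F K N))%:R / (q ^ N)%N%:R : R) @ \oo --> L)%classic ->
  ((fun N => (count_degree T N * N)%N%:R / (q ^ N)%N%:R : R) @ \oo --> L)%classic.
Proof.
move=> Tirr Tok cL; have q1 : (1 < q)%N := finNzRing_gt1 F.
apply: (@squeeze_cvgr _ _ _ _
  (fun N => (count (ok N) (frob_points F K N))%:R / (q ^ N)%N%:R -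
            (\sum_(d < N./2.+1) q ^ d)%N%:R / (q ^ N)%N%:R) _ _ _ L _ cL); last first.
  by rewrite -[L]subr0; apply: cvgB => //; exact: cvg_low_degree.
near=> N; have N0 : (0 < N)%N by near: N; exact: nbhs_infty_gt.
have [h1 h2] := count_degree_points N0 Tirr (Tok N).
have QR : (0 : R) < (q ^ N)%N%:R by rewrite ltr0n expn_gt0 ltnW.
rewrite -mulrBl !ler_pM2r ?invr_gt0 // lerBlDr -natrD !ler_nat h1 andbT.
exact: h2.
Unshelve. all: by end_near. Qed.

Lemma relative_densityP (T : set {poly F}) (L : R) :
  ((fun N => (count_degree T N * N)%N%:R / (q ^ N)%N%:R : R) @ \oo --> L)%classic ->
  has_relative_density T L.
Proof.
move=> cT; have q1 : (1 < q)%N := finNzRing_gt1 F.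
have QR N : (0 : R) < (q ^ N)%N%:R by rewrite ltr0n expn_gt0 ltnW.
have cI : ((fun N => (count_degree (@monic_irreducibles F) N * N)%N%:R / (q ^ N)%N%:R : R)
    @ \oo --> (1 : R))%classic.
  apply: (cvg_count_degree (ok := fun _ _ => true)) => //.
  have : ((fun _ : nat => 1 : R) @ \oo --> (1 : R))%classic by exact: cvg_cst.
  apply: cvg_trans; apply: near_eq_cvg; near=> N.
  have N0 : (0 < N)%N by near: N; exact: nbhs_infty_gt.
  by rewrite count_predT size_frob_points // divff // gt_eqF.
have cV : ((fun N => ((count_degree (@monic_irreducibles F) N * N)%N%:R / (q ^ N)%N%:R : R)^-1)
    @ \oo --> (1 : R))%classic.
  by rewrite -[X in (_ --> X)%classic]invr1; apply: (cvgV _ cI); rewrite oner_eq0.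
rewrite /has_relative_density -[L]mulr1; apply: cvg_trans (cvgM cT cV).
apply: near_eq_cvg; near=> N; have N0 : (0 < N)%N by near: N; exact: nbhs_infty_gt.
have NQ : (N%:R / (q ^ N)%N%:R : R) != 0 by rewrite mulf_neq0 ?invr_eq0 ?gt_eqF ?QR ?ltr0n.
rewrite /= !natrM -(mulrA (count_degree T N)%:R) -(mulrA (count_degree _ N)%:R).
by rewrite -mulf_div divff // mulr1.
Unshelve. all: by end_near. Qed.
End Density.

Theorem theorem3p4 (R : realType) (p : nat) (F : finFieldType)
    (hp : p \in [pchar F]) (l : nat) (D : 'I_l -> {fraction {poly F}})
    (hD : forall i, nonconstant (D i))
    (K : fieldExtType {fraction {poly F}}) (alpha : 'I_l -> K)
    (halpha : forall i, alpha i ^+ p - alpha i = (D i)%:A)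
    (hK : <<1 & codom alpha>>%VS = {:K}%VS)
    (hgeo : geometric_ext K) :
  has_relative_density (hasse_zero_set hp D)
    ((gamma_card p D)%:R / (p ^ l)%:R : R).
Proof.
have [C [iota _]] := countable_algebraic_closure F.
have pp := pcharf_prime hp; have p1 := prime_gt1 pp; have p0 := prime_gt0 pp.
have D0 i : D i != 0.
  by apply/eqP => Di0; apply: (hD i 0); rewrite Di0 /ratconst polyC0 tofrac0.
have q1 : (1 < #|F|)%N := finNzRing_gt1 F.
have Q0 N : (0 < #|F| ^ N)%N by rewrite expn_gt0 ltnW.
apply: (relative_densityP iota).
apply: (cvg_count_degree (iota := iota) (ok := fun N => zero_points p iota D N)).
- by move=> P [[iP mP] _].
- move=> N P x iP mP sP Px; exact: hasse_zero_setE.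
pose E N := frob_points F C N.
pose e N := (p ^ half_exp F p N)%N.
have e0 N : (0 < e N)%N by rewrite expn_gt0 p0.
have ecvg := @cvg_half_exp R F p hp.
have le_Ce k N : (k <= k * e N)%N by rewrite leq_pmulr.
have count_le (P : pred C) N : (0 < N)%N -> (count P (E N) <= #|F| ^ N)%N.
  by move=> N0; rewrite -(size_frob_points F C N0) count_size.
have cX : ((fun N => (count (regular iota D) (E N))%:R / (#|F| ^ N)%N%:R : R) @ \oo --> (1 : R))%classic.
  have [k hk] := count_regular_ge iota D.
  rewrite -[X in (_ --> X)%classic](divr1 1).
  apply: (@cvg_ratio R (fun N => count (regular iota D) (E N)) (fun N => #|F| ^ N)%N e 1 1 k 1)
    => // N N0; rewrite !mul1n; split.
    by apply: leq_trans (count_le _ _ N0) (leq_addr _ _).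
  by apply: leq_trans (hk N N0) _; rewrite leq_add2l.
pose triv (a : {ffun 'I_l -> 'F_p}) :=
  `[< exists G : ratfun F, \sum_(i < l) (a i : nat)%:R * D i = G ^+ p - G >].
pose La a : R := if triv a then 1 else p%:R^-1.
have cZ a : ((fun N => (comb_count iota D N a)%:R / (#|F| ^ N)%N%:R : R) @ \oo --> La a)%classic.
  rewrite /La /triv; case: asboolP => [[G hG]|nG].
    have [k hk] := comb_count_trivial hp iota (ex_intro _ G (etrans (subr0 _) hG)).
    have [k' hk'] := count_regular_ge iota D.
    rewrite -[X in (_ --> X)%classic](divr1 1).
    apply: (@cvg_ratio R (fun N => comb_count iota D N a) (fun N => #|F| ^ N)%N e 1 1 (k + k') 1)
      => // N N0; rewrite !mul1n; split.
      by apply: leq_trans (count_le _ _ N0) (leq_addr _ _).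
    apply: leq_trans (hk' N N0) _; apply: (@leq_trans (comb_count iota D N a + k + k')%N).
      by rewrite leq_add2r; apply: hk.
    by rewrite -addnA leq_add2l.
  have [|k [N1 hk]] := @comb_count_nontrivial _ _ hp _ iota _ D a.
    case=> c hc; apply: nG.
    by have [G] := geometric_as_equiv hp halpha hgeo hc; rewrite subr0; exists G.
  rewrite -[X in (_ --> X)%classic]mul1r.
  apply: (@cvg_ratio R (fun N => comb_count iota D N a) (fun N => #|F| ^ N)%N e p 1 k N1)
    => // N hN; rewrite mul1n; exact: hk.
have cS := cvg_fin_sum cZ.
have pl0 : (p ^ l)%N%:R != 0 :> R by rewrite gt_eqF // ltr0n expn_gt0 p0.
have p10 : (p%:R - 1 : R) != 0 by rewrite subr_eq0 (eqr_nat R p 1) gtn_eqF.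
have pR0 : (p%:R : R) != 0 by rewrite gt_eqF // ltr0n.
have sumLa : \sum_a La a = (gamma_card p D)%:R + ((p ^ l)%N%:R - (gamma_card p D)%:R) / p%:R.
  have LaE a : La a = p%:R^-1 + (triv a)%:R * (1 - p%:R^-1).
    by rewrite /La; case: (triv a) => /=; rewrite ?mul1r ?mul0r ?addr0 // addrC subrK.
  rewrite (eq_bigr _ (fun a _ => LaE a)) big_split /= sumr_const -mulr_suml -natr_sum.
  rewrite card_ffun card_Fp // card_ord -[_ *+ _]mulr_natr.
  have -> : (\sum_a triv a)%N = gamma_card p D.
    rewrite /gamma_card -sum1_card [RHS]big_mkcond; apply: eq_bigr => a _.
    by rewrite inE -/(triv a); case: (triv a).
  by field.
pose m (z x : R) := (p%:R * z - (p ^ l)%N%:R * x) / ((p ^ l)%N%:R * (p%:R - 1)).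
have -> : (gamma_card p D)%:R / (p ^ l)%N%:R = m (\sum_a La a) 1.
  by rewrite /m sumLa; field; rewrite pR0 p10 pl0.
have cm := @cvg_affine R _ _ _ _ p%:R (p ^ l)%N%:R ((p ^ l)%N%:R * (p%:R - 1))^-1 cS cX.
apply: cvg_trans cm; apply: near_eq_cvg; near=> N.
have N0 : (0 < N)%N by near: N; exact: nbhs_infty_gt.
have := sum_comb_count hp iota D N0.
move/(congr1 (fun k : nat => k%:R : R)); rewrite !natrD !natrM natr_sum -/(E N).
have QR : (#|F| ^ N)%N%:R != 0 :> R by rewrite gt_eqF // ltr0n.
rewrite /= -mulr_suml -/(E N).
set z := \sum_i _; set y := (count (zero_points _ _ _ _) _)%:R; set x := (count _ _)%:R.
move: (_ %:R) QR => Qr.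
move: (p ^ l)%N%:R pl0 => P P0 Qr0 h.
have e1 : p%:R * z - P * x = P * (p%:R - 1) * y.
  have -> : p%:R * z - P * x = p%:R * z + P * y - P * x - P * y by ring.
  by rewrite h; ring.
have -> : p%:R * (z / Qr) - P * (x / Qr) = P * (p%:R - 1) * (y / Qr).
  by rewrite !mulrA -mulrBl e1.
by rewrite mulrAC divff ?mul1r // mulf_neq0.
Unshelve. all: by end_near. Qed.
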